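(* Let $B_n^{\mathrm{rgf}}(t)=\sum_\omega t^{\mu(\omega)}$, the sum being over the restricted growth functions (RGFs) $\omega$ of length $n$, and let $B^{\mathrm{rgf}}(x,t)=\sum_{n\geq1}B_n^{\mathrm{rgf}}(t)x^n$. Let $$S^{\mathrm{rgf}}_{\geq3}(x,y)=\sum_{\substack{\sigma\text{ simple RGF}\\|\sigma|\geq3}}x^{|\sigma|-\mu(\sigma)}y^{\mu(\sigma)},\qquad S^{\mathrm{rgf}}(x)=\sum_{n\geq1}s^{\mathrm{rgf}}_nx^n,$$ where $s_n^{\mathrm{rgf}}$ is the number of simple RGFs of length $n$. Then $$1+\sum_{n\geq1}B_n^{\mathrm{rgf}}(t)\frac{z^n}{n!}=\exp\bigl(tz+e^z-1-z\bigr),$$ and, for $n\geq1$, $$B_n^{\mathrm{rgf}}(t)=\sum_{k=1}^{n}\sum_{j=0}^{k}\binom{n}{j}{n-j\brace k-j}(t-1)^j.$$ Moreover, for $n\geq1$ and $0\leq j\leq n$, $$[t^j]\,B_n^{\mathrm{rgf}}(t)=\binom{n}{j}\sum_{i\geq0}{n-j\brace i}_{\geq2}.$$ Furthermore, $$S_{\geq3}^{\mathrm{rgf}}\bigl(x,B^{\mathrm{rgf}}(x,t)\bigr)=B^{\mathrm{rgf}}(x,t)-tx-x^2-\frac{B^{\mathrm{rgf}}(x,t)^2}{1+B^{\mathrm{rgf}}(x,t)},$$ and, letting $U^{\mathrm{rgf}}(x)$ be the unique formal power series with $B^{\mathrm{rgf}}\bigl(x,U^{\mathrm{rgf}}(x)\bigr)=x$,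 $$S^{\mathrm{rgf}}(x)=2x+\frac{x^3}{1+x}-x\,U^{\mathrm{rgf}}(x).$$
   Context: Write $[n]=\{1,\ldots,n\}$. A Cayley permutation of length $n$ is a word $\omega=w_1\cdots w_n$ of positive integers whose set of letters is $[m]$ for some $m\leq n$; equivalently a map $\omega:[n]\to[n]$, $\omega(i)=w_i$, with image $[m]$; $|\omega|=n$ is its length. $\mu(\omega)=\#\{j:|\omega^{-1}(j)|=1\}$ is the number of values occurring exactly once in $\omega$. A Cayley permutation $w_1\cdots w_n$ is a restricted growth function (RGF) if $w_1=1$ and $w_{i+1}\leq\max(w_1,\ldots,w_i)+1$ for $1\leq i<n$. A nonempty interval of positions $I=[a,b]\subseteq[n]$ is an H-interval of a Cayley permutation $\omega$ of length $n$ if there is an interval of values $J=[c,d]$ with $\omega(I)=J$ and $\omega^{-1}(J)=I$. $\omega$ is simple if every H-interval of $\omega$ is a singleton or equals $[n]$. A simple RGF is an RGF that is simple as a Cayley permutation. ${n\brace k}$ is the Stirling number of the second kind (the number of partitions of an $n$-set into $k$ nonempty blocks, with ${0\brace 0}=1$), and ${n\brace k}_{\geq2}$ is the number of such partitions in which every block has size at least two (with ${0\brace 0}_{\geq2}=1$). $[t^j]$ denotes coefficient extraction. The series $B^{\mathrm{rgf}}$ has the form $tx+\sum_{k\geq2}B^{\mathrm{rgf}}_k(t)x^k$ with coefficients in $\mathbb{Z}[t]$, and there is exactly one formal power series $U^{\mathrm{rgf}}(x)\in\mathbb{Z}[[x]]$ with $B^{\mathrm{rgf}}(x,U^{\mathrm{rgf}}(x))=x$.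 *)

(* Defs.v *)
From HB Require Import structures.
From mathcomp Require Import all_boot all_order all_algebra.
From mathcomp Require Import boolp.

Set Implicit Arguments.
Unset Strict Implicit.
Unset Printing Implicit Defensive.

Import Order.TTheory GRing.Theory Num.Theory.

(* Positions and letters of Cayley permutations are shifted to start at 0:    *)
(* i : 'I_n stands for the position, or the letter, i + 1 of [n].             *)

Definition word (n : nat) := {ffun 'I_n -> 'I_n}.

Section Words.

Variable n : nat.
Implicit Types (w : word n) (I : {set 'I_n}).

Definition is_cayley w : bool :=
  [exists m : 'I_n.+1, [set w i | i in [set: 'I_n]] == [set v : 'I_n | v < m]].

Definition mu w : nat := #|[set j : 'I_n | #|w @^-1: [set j]| == 1]|.

Definition is_rgf w : bool :=
  [&& is_cayley w,
      [forall i : 'I_n, (i == 0 :> nat) ==> (w i == 0 :> nat)]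
    & [forall i : 'I_n, forall i' : 'I_n, (i' == i.+1 :> nat) ==>
         (w i' <= (\max_(k < n | k <= i) w k).+1)]].

Definition itv_set (a b : 'I_n) : {set 'I_n} := [set i : 'I_n | a <= i <= b].

Definition is_Hinterval w I : bool :=
  [exists a : 'I_n, exists b : 'I_n, [&& a <= b, I == itv_set a b
     & [exists c : 'I_n, exists d : 'I_n,
          ([set w i | i in I] == itv_set c d) && (w @^-1: itv_set c d == I)]]].

Definition is_simple w : bool :=
  is_cayley w &&
  [forall I : {set 'I_n}, is_Hinterval w I ==> ((#|I| == 1) || (I == [set: 'I_n]))].

Definition is_simple_rgf w : bool := is_rgf w && is_simple w.

End Words.

Definition stirling2 (n k : nat) : nat :=
  #|[set P : {set {set 'I_n}} | partition P [set: 'I_n] & #|P| == k]|.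

(* Vanishes for k > n, so that sums over k >= 0 may stop at k = n.            *)
Definition stirling2_ge2 (n k : nat) : nat :=
  #|[set P : {set {set 'I_n}} | partition P [set: 'I_n]
       & (#|P| == k) && [forall A in P, 2 <= #|A|]]|.

Local Open Scope ring_scope.

Record fps (R : Type) := Fps { fcoef :> nat -> R }.

Lemma fpsP (R : Type) (f g : fps R) : (forall n, f n = g n) -> f = g.
Proof. by case: f g => [f] [g] /= fg; congr Fps; apply/funext. Qed.

HB.instance Definition _ (R : Type) := gen_eqMixin (fps R).
HB.instance Definition _ (R : Type) := gen_choiceMixin (fps R).

Section FpsRing.

Variable R : comNzRingType.
Implicit Types f g h : fps R.

Definition fpsC (c : R) : fps R := Fps (fun n => if n is 0%N then c else 0).
Definition fpsX : fps R := Fps (fun n => if n is 1%N then 1 else 0).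
Definition fps_opp f := Fps (fun n => - f n).
Definition fps_add f g := Fps (fun n => f n + g n).
Definition fps_mul f g := Fps (fun n => \sum_(i < n.+1) f i * g (n - i)%N).

Lemma fps_addA : associative fps_add.
Proof. by move=> f g h; apply: fpsP => n /=; rewrite addrA. Qed.

Lemma fps_addC : commutative fps_add.
Proof. by move=> f g; apply: fpsP => n /=; rewrite addrC. Qed.

Lemma fps_add0 : left_id (fpsC 0) fps_add.
Proof. by move=> f; apply: fpsP => -[|n] /=; rewrite add0r. Qed.

Lemma fps_addN : left_inverse (fpsC 0) fps_opp fps_add.
Proof. by move=> f; apply: fpsP => -[|n] /=; rewrite addNr. Qed.

HB.instance Definition _ :=
  GRing.isZmodule.Build (fps R) fps_addA fps_addC fps_add0 fps_addN.

Let trunc N f : {poly R} := \poly_(i < N) f i.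

Let fps_mul_poly N (p q : {poly R}) f g :
  (forall i, (i < N)%N -> p`_i = f i) -> (forall i, (i < N)%N -> q`_i = g i) ->
  forall i, (i < N)%N -> (p * q)`_i = fps_mul f g i.
Proof.
move=> pf qg i iN; rewrite coefM; apply: eq_bigr => j _.
rewrite pf ?qg //; first exact: leq_ltn_trans (leq_subr _ _) iN.
by apply: leq_ltn_trans iN; rewrite -ltnS.
Qed.

Let coef_trunc N f i : (i < N)%N -> (trunc N f)`_i = f i.
Proof. by move=> iN; rewrite coef_poly iN. Qed.

Lemma fps_mulA : associative fps_mul.
Proof.
move=> f g h; apply: fpsP => n; set N := n.+1.
have cT k := @coef_trunc N k.
have M k1 k2 := @fps_mul_poly N _ _ k1 k2.
rewrite -(M _ _ _ _ (cT f) (M _ _ _ _ (cT g) (cT h))) //.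
by rewrite -(M _ _ _ _ (M _ _ _ _ (cT f) (cT g)) (cT h)) // mulrA.
Qed.

Lemma fps_mulC : commutative fps_mul.
Proof.
move=> f g; apply: fpsP => n; set N := n.+1.
have cT k := @coef_trunc N k.
rewrite -(fps_mul_poly (cT f) (cT g)) // mulrC.
exact: (fps_mul_poly (cT g) (cT f)).
Qed.

Lemma fps_mul1 : left_id (fpsC 1) fps_mul.
Proof.
move=> f; apply: fpsP => n /=; rewrite big_ord_recl /= mul1r subn0.
by rewrite big1 ?addr0 // => i _; rewrite mul0r.
Qed.

Lemma fps_mulDl : left_distributive fps_mul fps_add.
Proof.
move=> f g h; apply: fpsP => n /=; rewrite -big_split /=.
by apply: eq_bigr => i _; rewrite mulrDl.
Qed.

Lemma fps_oner_neq0 : fpsC 1 != fpsC 0.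
Proof.
by apply/eqP => /(congr1 (fun f : fps R => f 0%N)) /= /eqP; rewrite oner_eq0.
Qed.

HB.instance Definition _ := GRing.Zmodule_isComNzRing.Build (fps R)
  fps_mulA fps_mulC fps_mul1 fps_mulDl fps_oner_neq0.

(* As always in MathComp, f^-1 = f when f is not invertible; see fps_unit.    *)
Definition fps_unit_pred : pred (fps R) := fun f => `[< exists g, g * f = 1 >].

Definition fps_inv f : fps R :=
  if pselect (exists g, g * f = 1) is left ex then projT1 (cid ex) else f.

Lemma fps_mulVr : {in fps_unit_pred, left_inverse 1 fps_inv *%R}.
Proof.
move=> f /asboolP uf; rewrite /fps_inv; case: pselect => // ex.
by case: (cid ex).
Qed.

Lemma fps_unitP f g : g * f = 1 -> fps_unit_pred f.
Proof. by move=> gf; apply/asboolP; exists g. Qed.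

Lemma fps_inv_out : {in [predC fps_unit_pred], fps_inv =1 id}.
Proof.
by move=> f /asboolPn nuf; rewrite /fps_inv; case: pselect.
Qed.

HB.instance Definition _ := GRing.ComNzRing_hasMulInverse.Build (fps R)
  fps_mulVr fps_unitP fps_inv_out.

Lemma fcoefD f g n : (f + g) n = f n + g n. Proof. by []. Qed.
Lemma fcoefN f n : (- f) n = - f n. Proof. by []. Qed.
Lemma fcoefM f g n : (f * g) n = \sum_(i < n.+1) f i * g (n - i)%N.
Proof. by []. Qed.
Lemma fcoef1 n : (1 : fps R) n = (n == 0%N)%:R. Proof. by case: n. Qed.

Lemma fcoef_sum I (r : seq I) (P : pred I) (F : I -> fps R) n :
  (\sum_(i <- r | P i) F i) n = \sum_(i <- r | P i) F i n.
Proof. by elim/big_rec2: _ => [|i y f _ <-] //; case: n. Qed.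

Lemma fcoefX_lt f k n : f 0%N = 0 -> (n < k)%N -> (f ^+ k) n = 0.
Proof.
move=> f0; elim: k n => // k IHk n nk; rewrite exprS fcoefM.
apply: big1 => -[[|i] /= ni] _; first by rewrite f0 mul0r.
case: n nk ni => // n nk _.
by rewrite IHk ?mulr0 // subSS (leq_ltn_trans (leq_subr _ _)).
Qed.

(* In particular 1 + f is invertible whenever f has no constant term.         *)
Lemma fps_unit f : f 0%N = 1 -> f \is a GRing.unit.
Proof.
move=> f1; pose h := 1 - f.
have h0 : h 0%N = 0 by rewrite /h fcoefD fcoefN fcoef1 f1 subrr.
pose S N : fps R := \sum_(k < N) h ^+ k.
pose g : fps R := Fps (fun n => S n.+1 n).
have gS N n : (n < N)%N -> g n = S N n.
  move=> nN; rewrite -(subnKC nN) /S big_split_ord fcoefD.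
  by rewrite [X in _ + X]fcoef_sum [X in _ + X]big1 ?addr0 // => i _;
     rewrite fcoefX_lt // ltnS leq_addr.
have fE : f = 1 - h by rewrite /h opprB addrC subrK.
suff gf : g * f = 1 by apply: (fps_unitP gf).
apply: fpsP => n.
have -> : (g * f) n = (S n.+1 * f) n.
  by rewrite !fcoefM; apply: eq_bigr => i _; rewrite (gS n.+1).
have -> : S n.+1 * f = 1 - h ^+ n.+1.
  rewrite fE mulrC -[X in X - h ^+ _](expr1n _ n.+1) subrXX.
  by congr (_ * _); apply: eq_bigr => i _; rewrite expr1n mul1r.
by rewrite fcoefD fcoefN fcoefX_lt // subr0.
Qed.

(* \sum_k F k, meaningful when F k has order at least k (i.e. F k n = 0 for   *)
(* n < k), as is the case at each use below.                                  *)
Definition fps_sum (F : nat -> fps R) : fps R :=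
  Fps (fun n => \sum_(k < n.+1) F k n).

End FpsRing.

Arguments fpsX {R}.

(* f(u): the variable t of the coefficients of f is replaced by u.            *)
Definition fps_subst_param (R : comNzRingType) (f : fps {poly R}) (u : fps R) :
    fps R :=
  fps_sum (fun k => (map_poly (@fpsC R) (f k)).[u] * fpsX ^+ k).

(* S(a, b), for a and b without constant term. A series in Z[[x, y]] is seen  *)
(* as an element of Z[[y]][[x]]: S i j is the coefficient of x^i y^j.         *)
Definition fps_eval2 (R : comNzRingType) (S : fps (fps int)) (a b : fps R) :
    fps R :=
  fps_sum (fun i => fps_sum (fun j => (a ^+ i * b ^+ j) *~ S i j)).

(* exp(f), for f without constant term. *)
Definition fps_exp (A : comAlgType rat) (f : fps A) : fps A :=
  fps_sum (fun k => fpsC ((k`!%:R^-1 : rat)%:A) * f ^+ k).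

(* \sum_(n >= 1) a n x^n *)
Definition fps_ge1 (R : comNzRingType) (a : nat -> R) : fps R :=
  Fps (fun n => if n is 0%N then 0 else a n).

Definition Brgf (n : nat) : {poly int} :=
  \sum_(w : word n | is_rgf w) 'X^(mu w).

Definition Brgf_fps : fps {poly int} := fps_ge1 Brgf.

(* 1 + \sum_(n >= 1) B_n(t) z^n / n!, with coefficients in Q[t]               *)
Definition Brgf_egf : fps {poly rat} :=
  1 + fps_ge1 (fun n => (n`!%:R^-1 : rat) *: map_poly intr (Brgf n)).

(* A word contributing to x^i y^j has length i + j. *)
Definition Srgf_ge3 : fps (fps int) :=
  Fps (fun i => Fps (fun j =>
    if (3 <= i + j)%N
    then #|[set w : word (i + j) | is_simple_rgf w & mu w == j]|%:Z else 0)).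

Definition srgf (n : nat) : nat := #|[set w : word n | is_simple_rgf w]|.

Definition Srgf_fps : fps int := fps_ge1 (fun n => (srgf n)%:Z).

(* Main.v *)
(** An RGF is determined by its kernel, the set partition of the positions into
    level sets, and [mu] counts the singleton blocks. Splitting off the block
    of one point gives a recursion for weighted partitions; changing the weight
    of singletons from [w] to [w + c] is a binomial convolution with powers of
    [c], which yields both closed formulas, and the recursion is the
    differential equation satisfied by the exponential.

    For RGFs, values appear in increasing order, so an H-interval is just an
    interval of positions that is a union of level sets ("closed"); simplicity
    is thus a property of the kernel. If no proper nonempty prefix is closed,
    maximal proper closed intervals are disjoint, and contracting them exhibits
    an RGF of length at least 3 as an inflation of a unique simple RGF of length
    at least 3 at letters that occur once. Writing [Ind] for the series of RGFs
    without closed proper prefix, this says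
    [Ind = t x + x^2 + S_{>=3}(x, B)], while cutting at the first closed prefix
    gives [B = Ind + Ind B], i.e. [B^2 / (1 + B) = B - Ind]. The last identity
    follows by substituting [U] for [t]; [U] is the fixed point of a map that is
    contracting for the x-adic topology. *)

From HB Require Import structures.
Require Import Defs.
From mathcomp Require Import all_boot all_order all_algebra.
From mathcomp Require Import zify ring.
From mathcomp Require Import boolp.

Set Implicit Arguments.
Unset Strict Implicit.
Unset Printing Implicit Defensive.
Import Order.TTheory GRing.Theory Num.Theory.

(** * Weighted set partitions *)

Local Open Scope ring_scope.

Section WeightedPartitions.

Variable R : comNzRingType.
Implicit Type w : nat -> R.

(** All statements about RGFs are reduced to equalities between letters: RGFs of the same length
    with the same equalities coincide, so a word may be built on any alphabet (blocks, pairs) and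
    standardized afterwards. Inflation is accordingly a relation between kernels. Uniqueness is
    proved from the relation, and an explicit construction realizes it; cutting a word in two is the
    case of the outer word 01. Length 2 has to be kept apart. Only letters occurring once can be
    inflated, so 00 yields nothing but itself, the term x^2; and a word may be an inflation of 01 in
    several ways, so uniqueness there comes from asking that the first part have no closed proper
    prefix. The maximal proper closed intervals are disjoint because two overlapping ones cannot
    cover the word: one of them would be a closed proper prefix. Infinite sums are never
    manipulated: each coefficient is read off a finite list of words. *)

Definition part_weight w (T : finType) (D : {set T}) : R :=
  \sum_(P : {set {set T}} | partition P D) \prod_(A in P) w #|A|.

Lemma part_weight0 w (T : finType) : part_weight w (set0 : {set T}) = 1.
Proof.
rewrite /part_weight (big_pred1 set0) ?big_set0 // => P.
exact: partition_set0.
Qed.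

(** For a fixed block [B] of [x], the map [P |-> P :\ B] is a bijection onto the partitions of
    [D :\: B], with inverse [P |-> B |: P]. *)
Lemma part_weight_block w (T : finType) (D : {set T}) x : x \in D ->
  part_weight w D =
  \sum_(B : {set T} | (x \in B) && (B \subset D)) w #|B| * part_weight w (D :\: B).
Proof.
move=> xD; rewrite /part_weight.
rewrite (partition_big (fun P => pblock P x)
  (fun B => (x \in B) && (B \subset D))) /=; last first.
  move=> P PD; rewrite mem_pblock (cover_partition PD) xD /=.
  by apply: (partitionS PD); rewrite pblock_mem // (cover_partition PD).
apply: eq_bigr => B /andP[xB BD]; rewrite big_distrr /=.
rewrite (reindex_onto (fun P => B |: P) (fun P => P :\ B)) /=; last first.
  move=> P /andP[PD /eqP <-]; apply: setD1K.
  by rewrite pblock_mem // (cover_partition PD).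
have nB P : partition P (D :\: B) -> B \notin P.
  move=> PD; apply/negP => /(partitionS PD)/subsetP/(_ x xB).
  by rewrite inE xB.
apply: eq_big => [P|P].
  apply/idP/idP => [/andP[/andP[PD _] /eqP eP]|PD].
    by rewrite -eP; apply: partitionD1 PD _; rewrite setU11.
  have disj : [disjoint D :\: B & B] by rewrite -setI_eq0 setIDAC setDIl setDv setI0.
  have PD' : partition (B |: P) D.
    have -> : D = B :|: (D :\: B) by rewrite setUC setDE setUIl (setUC (~: B)) setUCr setIT; apply/esym/setUidPl.
    apply: partitionU1 => //; first by apply/set0Pn; exists x.
    by rewrite disjoint_sym.
  rewrite PD' /= setU1K ?nB // eqxx andbT; apply/eqP.
  by apply: def_pblock => //; [exact: partition_trivIset PD' | rewrite setU11].
move=> /andP[/andP[PD _] /eqP eP]; rewrite big_setU1 //=.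
by rewrite -eP; rewrite !inE eqxx.
Qed.

Definition bell w n := part_weight w [set: 'I_n].

(** Such a [B] is [x] together with a [k]-subset of the [n] other points of [D], whence the binomial
    coefficient and the shift to [F k.+1]. *)
Lemma sum_sub_mem (T : finType) (D : {set T}) x (F : nat -> R) n :
  x \in D -> #|D| = n.+1 ->
  \sum_(B : {set T} | (x \in B) && (B \subset D)) F #|B| =
  \sum_(k < n.+1) F k.+1 *+ 'C(n, k).
Proof.
move=> xD cD'; have cD : #|D :\ x| = n.
  by move: cD'; rewrite [#|D|](cardsD1 x) xD => -[].
rewrite (reindex_onto (fun P => x |: P) (fun P => P :\ x)) /=; last first.
  by move=> P /andP[xP _]; apply: setD1K.
rewrite (eq_bigl (fun P : {set T} => P \subset D :\ x)); last first.
  move=> P; rewrite subsetD1 subUset sub1set xD setU11 /=.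
  case xP: (x \in P); last by rewrite setU1K ?xP // eqxx andbT.
  rewrite andbF; apply/negbTE; rewrite negb_and; apply/orP; right.
  by apply/eqP => eP; move: xP; rewrite -eP !inE eqxx.
rewrite (partition_big (fun P : {set T} => inord #|P| : 'I_n.+1) xpredT) //=.
apply: eq_bigr => k _.
rewrite (eq_bigr (fun _ => F k.+1)); last first.
  move=> P /andP[PD /eqP eP]; rewrite cardsU1.
  have -> : x \notin P by apply/negP => /(subsetP PD); rewrite !inE eqxx.
  rewrite -eP inordK //= ltnS -cD; exact: subset_leq_card.
rewrite sumr_const; congr (_ *+ _).
rewrite -[X in 'C(X, _)]cD -cards_draws -cardsE; apply: eq_card => P; rewrite !inE.
rewrite unfold_in; case PD : (P \subset _) => //=.
apply/eqP/eqP => [<-|eP]; first by rewrite inordK // ltnS -cD subset_leq_card.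
by apply/val_inj; rewrite /= eP inordK.
Qed.

(** Removing a block leaves a set that is no longer a full ordinal type, so the induction runs over
    all finite types at once; the recursion sees only cardinals. *)
Lemma part_weight_card w n (T : finType) (D : {set T}) :
  #|D| = n -> part_weight w D = bell w n.
Proof.
elim/ltn_ind: n T D => -[|n] IH T D.
  move/eqP; rewrite cards_eq0 => /eqP ->; rewrite part_weight0.
  by rewrite /bell (_ : setT = set0) ?part_weight0 //; apply/setP => -[].
pose F k := w k * bell w (n.+1 - k).
suff H (T' : finType) (D' : {set T'}) : #|D'| = n.+1 ->
    part_weight w D' = \sum_(k < n.+1) F k.+1 *+ 'C(n, k).
  by move=> cD; rewrite (H _ _ cD) /bell H // cardsT card_ord.
move=> cD; have /card_gt0P[x xD] : (0 < #|D'|)%N by rewrite cD.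
rewrite (part_weight_block _ xD) -(sum_sub_mem F xD cD); apply: eq_bigr => B /andP[xB BD].
have B0 : (0 < #|B|)%N by apply/card_gt0P; exists x.
have cDB : #|D' :\: B| = (n.+1 - #|B|)%N by rewrite cardsDS ?cD.
by rewrite (IH _ _ _ _ cDB) //; lia.
Qed.

Lemma bell0 w : bell w 0 = 1.
Proof. by rewrite -(@part_weight_card w 0 'I_0 set0) ?cards0 ?part_weight0. Qed.

Lemma bellS w n :
  bell w n.+1 = \sum_(k < n.+1) (w k.+1 * bell w (n - k)) *+ 'C(n, k).
Proof.
have cD : #|[set: 'I_n.+1]| = n.+1 by rewrite cardsT card_ord.
rewrite /bell (part_weight_block _ (in_setT ord0)).
rewrite -(sum_sub_mem (fun k => w k * bell w (n.+1 - k)) (in_setT ord0) cD).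
apply: eq_bigr => B _.
by rewrite (@part_weight_card w (n.+1 - #|B|)) // cardsDS ?cD ?subsetT.
Qed.

(** Expand the weight [w 1 + c] of each singleton: choosing [c] for [j] marked singletons gives
    ['C(n, j)] and [c ^+ j], and the other points are partitioned with weight [w]. The proof checks
    that the right-hand side obeys the recursion [bellS]. *)
Lemma bell_singleton w w' c : w' 1%N = w 1%N + c ->
  (forall k, (1 < k)%N -> w' k = w k) ->
  forall n, bell w' n = \sum_(j < n.+1) (c ^+ j * bell w (n - j)) *+ 'C(n, j).
Proof.
move=> w1 wk; elim/ltn_ind => -[|n] IH.
  by rewrite big_ord1 !bell0 mulr1.
(* The distinguished point is either a singleton carrying the extra [c], or in a block with its old
   weight. *)
transitivity (c * bell w' n + \sum_(k < n.+1) (w k.+1 * bell w' (n - k)) *+ 'C(n, k)).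
  rewrite bellS [LHS]big_ord_recl [in RHS]big_ord_recl /= w1 mulrDl mulrnDl addrAC bin0 addrC mulr1n.
  by rewrite subn0; congr (_ + (_ + _)); apply: eq_bigr => i _; rewrite wk.
rewrite [RHS]big_ord_recl /= bin0 mulr1n expr0 mul1r subn0.
(* Pascal's rule: the terms in ['C(n, j)] are those where the distinguished point is one of the
   marked singletons. *)
under [X in _ = _ + X]eq_bigr => j _ do rewrite /= binS mulrnDr.
rewrite big_split /= [X in _ = _ + X]addrC addrCA; congr (_ + _).
  rewrite IH // mulr_sumr; apply: eq_bigr => j _.
  by rewrite mulrnAr mulrA -exprS /bump /= add1n subSS.
(* These are the terms where the distinguished point is not marked; the topmost one vanishes since
   ['C(n, n.+1)] is 0. *)
have -> : bell w n.+1 + \sum_(i < n.+1)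
    (c ^+ bump 0 i * bell w (n.+1 - bump 0 i)) *+ 'C(n, i.+1) =
    \sum_(j < n.+1) (c ^+ j * bell w (n - j).+1) *+ 'C(n, j).
  rewrite [RHS]big_ord_recl bin0 mulr1n expr0 mul1r subn0; congr (_ + _).
  rewrite big_ord_recr /= bin_small // mulr0n addr0; apply: eq_bigr => i _.
  by rewrite /bump /= add1n subSS subnSK.
transitivity (\sum_(k < n.+1) \sum_(j < n.+1 | (j + k <= n)%N)
   (c ^+ j * (w k.+1 * bell w (n - j - k))) *+ ('C(n, j) * 'C(n - j, k))).
  apply: eq_bigr => k _; have kn : (k <= n)%N by rewrite -ltnS.
  rewrite IH; last by lia.
  rewrite mulr_sumr -sumrMnl.
  rewrite (big_ord_widen_cond n.+1 xpredT
     (fun j => (w k.+1 * ((c ^+ j * bell w (n - k - j)) *+ 'C(n - k, j))) *+ 'C(n, k)));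
     last by lia.
  rewrite (eq_bigl (fun j : 'I_n.+1 => (j + k <= n)%N)); last by move=> j; rewrite /=; lia.
  apply: eq_bigr => j jk; rewrite mulrnAr -mulrnA mulrCA subnAC; congr (_ *+ _).
  have jkn : (j <= n - k)%N by lia.
  have kjn : (k <= n - j)%N by lia.
  (* Trinomial symmetry: both products of binomials equal n! / (j! k! (n-j-k)!). *)
  have h1 := bin_fact kn.
  have h2 := bin_fact jkn.
  have h3 := bin_fact (leq_trans jkn (leq_subr _ _)).
  have h4 := bin_fact kjn.
  apply/eqP; rewrite -(eqn_pmul2r (fact_gt0 k)) -(eqn_pmul2r (fact_gt0 j)).
  rewrite -(eqn_pmul2r (fact_gt0 (n - j - k))); apply/eqP.
  rewrite -h2 subnAC in h1; rewrite -h4 in h3; lia.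
rewrite (exchange_big_dep xpredT) // /=; apply: eq_bigr => j _.
rewrite bellS mulr_sumr -sumrMnl.
have jn : (j <= n)%N by rewrite -ltnS.
rewrite (big_ord_widen_cond n.+1 xpredT (fun k =>
  (c ^+ j * ((w k.+1 * bell w (n - j - k)) *+ 'C(n - j, k))) *+ 'C(n, j)));
  last by lia.
apply: eq_big => [k|k _]; first by rewrite /=; lia.
by rewrite mulrnAr -mulrnA mulnC.
Qed.

End WeightedPartitions.

(** * Restricted growth functions as lists *)

Local Open Scope nat_scope.

Section FirstOccurrences.
Variable T : eqType.
Implicit Type s : seq T.

(** [undup] keeps last occurrences; the two reversals make it list the letters by first
    occurrence. *)
Definition firsts s := rev (undup (rev s)).

Lemma firsts_rcons s x :
  firsts (rcons s x) = if x \in s then firsts s else rcons (firsts s) x.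
Proof.
by rewrite /firsts rev_rcons /= mem_rev; case: ifP => // _; rewrite rev_cons.
Qed.

Lemma mem_firsts s : firsts s =i s.
Proof. by move=> x; rewrite mem_rev mem_undup mem_rev. Qed.

(** The canonical representative of the kernel of [s]: the only RGF with the same equalities between
    letters. *)
Definition std s := [seq index x (firsts s) | x <- s].

Lemma size_std s : size (std s) = size s.
Proof. exact: size_map. Qed.

Lemma nth_std x0 s i : i < size s ->
  nth 0 (std s) i = index (nth x0 s i) (firsts s).
Proof. by move=> si; rewrite (nth_map x0). Qed.

Lemma std_kernel x0 s i j : i < size s -> j < size s ->
  (nth 0 (std s) i == nth 0 (std s) j) = (nth x0 s i == nth x0 s j).
Proof.
move=> si sj; rewrite !(nth_std x0) //.
rewrite (inj_in_eq (f := index^~ (firsts s)) (@index_inj _ x0 _)) //.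
  by rewrite mem_firsts mem_nth.
by rewrite mem_firsts mem_nth.
Qed.

Lemma std_rcons s x :
  std (rcons s x) = rcons (std s) (index x (firsts s)).
Proof.
rewrite /std map_rcons firsts_rcons; case: ifP => // xs.
rewrite -[rcons (firsts s) x]cats1; congr rcons.
  by apply/eq_in_map => y ys; rewrite index_cat mem_firsts ys.
by rewrite index_cat mem_firsts xs /= eqxx addn0 memNindex // mem_firsts xs.
Qed.

End FirstOccurrences.

Lemma firsts_map (T U : eqType) (f : T -> U) (s : seq T) :
  {in s &, injective f} -> firsts (map f s) = map f (firsts s).
Proof.
elim/last_ind: s => // s x IH fi.
rewrite map_rcons !firsts_rcons IH; last first.
  by move=> y z ys zs; apply: fi; rewrite mem_rcons inE (ys, zs) orbT.
have -> : (f x \in map f s) = (x \in s).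
  apply/mapP/idP => [[y ys /fi ->] //|xs]; last by exists x.
    by rewrite mem_rcons mem_head.
  by rewrite mem_rcons inE ys orbT.
by case: ifP => // _; rewrite map_rcons.
Qed.

Lemma index_map_in (T U : eqType) (f : T -> U) (s : seq T) x :
  {in x :: s &, injective f} -> index (f x) (map f s) = index x s.
Proof.
elim: s => //= y s IH fi; rewrite (inj_in_eq fi) ?inE ?eqxx ?orbT // IH //.
by move=> a b; rewrite !inE => ha hb; apply: fi; rewrite !inE;
  [case/orP: ha => -> | case/orP: hb => ->]; rewrite ?orbT.
Qed.

Lemma std_map (T U : eqType) (f : T -> U) (s : seq T) :
  {in s &, injective f} -> std (map f s) = std s.
Proof.
move=> fi; rewrite /std firsts_map // -map_comp; apply/eq_in_map => x xs /=.
apply: index_map_in => y z; rewrite !inE !mem_firsts => hy hz; apply: fi.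
  by case/orP: hy => // /eqP ->.
by case/orP: hz => // /eqP ->.
Qed.

(** The map sends a letter of [s] to the letter of [t] at the place of its first occurrence;
    equality of the kernels makes it injective. *)
Lemma map_of_kernel (T U : eqType) (x0 : T) (y0 : U) (s : seq T) (t : seq U) :
  size s = size t ->
  (forall i j, i < size s -> j < size s ->
     (nth x0 s i == nth x0 s j) = (nth y0 t i == nth y0 t j)) ->
  exists2 f, {in s &, injective f} & t = map f s.
Proof.
move=> st ker; pose f x := nth y0 t (index x s); exists f.
  move=> x y xs ys; rewrite -index_mem in xs; rewrite -index_mem in ys.
  move=> /eqP; rewrite -ker //; rewrite !index_mem in xs ys.
  by rewrite !nth_index // => /eqP.
apply: (@eq_from_nth _ y0); rewrite ?size_map // => i; rewrite -st => si.
rewrite (nth_map x0) // /f; apply/eqP; rewrite -ker //.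
  by rewrite nth_index ?mem_nth.
by rewrite index_mem mem_nth.
Qed.

Lemma eq_std (T U : eqType) (x0 : T) (y0 : U) (s : seq T) (t : seq U) :
  size s = size t ->
  (forall i j, i < size s -> j < size s ->
     (nth x0 s i == nth x0 s j) = (nth y0 t i == nth y0 t j)) ->
  std s = std t.
Proof.
by move=> st /(map_of_kernel st)[f fi ->]; rewrite std_map.
Qed.

(** Letters first appear in the order 0, 1, 2, and so on; [rgf_rcons] recovers the growth
    condition. *)
Definition rgf (s : seq nat) := firsts s == iota 0 (size (firsts s)).

Lemma mem_rgf s x : rgf s -> (x \in s) = (x < size (firsts s)).
Proof. by rewrite -mem_firsts => /eqP {1}->; rewrite mem_iota. Qed.

Lemma rgf_rcons s x : rgf (rcons s x) = rgf s && (x <= size (firsts s)).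
Proof.
rewrite {1}/rgf firsts_rcons; case: ifP => xs.
  rewrite -/(rgf s); case rs: (rgf s) => //=; apply/esym/ltnW.
  by rewrite -mem_rgf.
rewrite size_rcons -addn1 iotaD add0n cats1 eqseq_rcons -/(rgf s).
case rs: (rgf s) => //=; rewrite leq_eqVlt; move: xs.
by rewrite mem_rgf // => ->; rewrite orbF.
Qed.

Lemma rgf_std (T : eqType) (s : seq T) : rgf (std s).
Proof.
elim/last_ind: s => // s x IH; rewrite std_rcons rgf_rcons IH /=.
have -> : size (firsts (std s)) = size (firsts s).
  rewrite firsts_map ?size_map // => y z ys zs; apply: (index_inj y);
    by rewrite mem_firsts.
exact: index_size.
Qed.

Lemma std_id s : rgf s -> std s = s.
Proof.
move=> rs; rewrite -[RHS]map_id; apply/eq_in_map => x xs.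
rewrite mem_rgf // in xs; rewrite (eqP rs).
by rewrite -{1}[x](@nth_iota 0 0 _ x xs) index_uniq ?iota_uniq ?size_iota.
Qed.

Lemma rgf_take s k : rgf s -> rgf (take k s).
Proof.
elim/last_ind: s k => // s x IH k; rewrite rgf_rcons => /andP[rs xs].
rewrite -cats1 take_cat; case: ltnP => _; first exact: IH.
by case: (k - size s) => [|m] /=; rewrite ?cats0 // cats1 rgf_rcons rs.
Qed.

Lemma rgf_inj s t : rgf s -> rgf t -> size s = size t ->
  (forall i j, i < size s -> j < size s ->
     (nth 0 s i == nth 0 s j) = (nth 0 t i == nth 0 t j)) -> s = t.
Proof.
by move=> rs rt st /(eq_std st); rewrite !std_id.
Qed.

(** Counts positions where [mu] counts values: a value occurring once occupies one position. *)
Definition mus (T : eqType) (s : seq T) := count (fun x => count_mem x s == 1) s.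

Lemma count_mem_map_in (T U : eqType) (f : T -> U) (s : seq T) x :
  {in x :: s &, injective f} -> count_mem (f x) (map f s) = count_mem x s.
Proof.
move=> fi; rewrite count_map; apply: eq_in_count => y ys /=.
by apply: (inj_in_eq fi); rewrite !inE ?eqxx ?ys ?orbT.
Qed.

Lemma mus_map (T U : eqType) (f : T -> U) (s : seq T) :
  {in s &, injective f} -> mus (map f s) = mus s.
Proof.
move=> fi; rewrite /mus count_map; apply: eq_in_count => x xs /=.
rewrite count_mem_map_in // => y z; rewrite !inE => hy hz; apply: fi.
  by case/orP: hy => // /eqP ->.
by case/orP: hz => // /eqP ->.
Qed.

Lemma mus_std (T : eqType) (s : seq T) : mus (std s) = mus s.
Proof.
by apply: mus_map => x y xs ys; apply: (index_inj x); rewrite mem_firsts.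
Qed.

(** The interval of positions is half-open, so that adjacent intervals share an endpoint. *)
Definition closed_itv (T : Type) (x0 : T) s a b :=
  [/\ a < b, b <= size s & forall i j, i < size s -> j < size s ->
      nth x0 s i = nth x0 s j -> a <= i < b -> a <= j < b].

Definition simple (s : seq nat) := forall a b, closed_itv 0 s a b ->
  b = a.+1 \/ (a = 0 /\ b = size s).

Definition decomp (s : seq nat) := exists2 k, 0 < k < size s & closed_itv 0 s 0 k.

(** * The words of the statement, read as lists *)

Section Words.
Variable n : nat.

Lemma nth_map_enum (T : Type) (f : 'I_n -> T) x0 (i : 'I_n) :
  nth x0 [seq f j | j <- enum 'I_n] i = f i.
Proof. by rewrite (nth_map i) ?size_enum_ord // nth_ord_enum. Qed.

Implicit Type w : word n.

Definition wseq w : seq nat := [seq val (w i) | i <- enum 'I_n].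

Lemma size_wseq w : size (wseq w) = n.
Proof. by rewrite size_map size_enum_ord. Qed.

Lemma nth_wseq w (i : 'I_n) : nth 0 (wseq w) i = w i.
Proof. exact: nth_map_enum. Qed.

Lemma wseq_inj : injective wseq.
Proof.
by move=> w w' e; apply/ffunP => i; apply: val_inj; rewrite /= -!nth_wseq e.
Qed.

Lemma mem_take_wseq w k x :
  x \in take k (wseq w) -> exists2 j : 'I_n, x = w j & j < k.
Proof.
move=> /(nthP 0)[i]; rewrite size_take_min size_wseq leq_min => /andP[ik in_].
by rewrite nth_take // => <-; exists (Ordinal in_) => //; rewrite -nth_wseq.
Qed.

Lemma take_wseqS w (i : 'I_n) : take i.+1 (wseq w) = rcons (take i (wseq w)) (w i).
Proof. by rewrite (take_nth 0) ?size_wseq // nth_wseq. Qed.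

(** The letters of an RGF are all those up to their maximum, so the bound in [is_rgf] is the number
    of distinct letters, which is the bound in [rgf_rcons]. *)
Lemma wseq_max w (i : 'I_n) : rgf (take i.+1 (wseq w)) ->
  (\max_(k < n | k <= i) w k).+1 = size (firsts (take i.+1 (wseq w))).
Proof.
move=> rt; apply/eqP; rewrite eqn_leq; apply/andP; split.
  have : size (firsts (take i.+1 (wseq w))) != 0.
    rewrite -lt0n (leq_ltn_trans (leq0n (w i))) // -mem_rgf //.
    by rewrite take_wseqS mem_rcons mem_head.
  case E : (size _) => [//|m] _; rewrite ltnS; apply/bigmax_leqP => k ki.
  rewrite -ltnS -E -mem_rgf //; apply/(nthP 0); exists k.
    by rewrite size_take_min size_wseq leq_min !ltnS ki ltn_ord.
  by rewrite nth_take // nth_wseq.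
case E : (size _) => [//|m]; rewrite ltnS.
have : m \in take i.+1 (wseq w) by rewrite mem_rgf // E.
by move=> /mem_take_wseq[j -> ji]; apply: leq_bigmax_cond.
Qed.

Lemma is_rgfP w : is_rgf w = rgf (wseq w).
Proof.
apply/idP/idP.
  move=> /and3P[_ /forallP w0 /forallP wS].
  (* Prefix by prefix, since [wseq_max] presupposes that the earlier prefix is an RGF. *)
  have H k : k <= n -> rgf (take k (wseq w)).
    elim: k => [|k IH] kn; first by rewrite take0.
    have := take_wseqS w (Ordinal kn) => /= ->; rewrite rgf_rcons IH ?(ltnW kn) //=.
    case: k IH kn => [|k] IH kn.
      by have /implyP/(_ isT)/eqP -> := w0 (Ordinal kn).
    have := wS (Ordinal (ltnW kn)) => /forallP/(_ (Ordinal kn))/implyP/(_ (eqxx _)).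
    by rewrite wseq_max // IH // ltnW.
  by have := H n (leqnn n); rewrite take_oversize // size_wseq.
move=> rw; apply/and3P; split.
- apply/existsP.
  have kn : size (firsts (wseq w)) < n.+1.
    by rewrite size_rev ltnS (leq_trans (size_undup _)) // size_rev size_wseq.
  exists (Ordinal kn); apply/eqP/setP => v; rewrite !inE /= -mem_rgf //.
  apply/imsetP/mapP => [[i _ ->]|[i _ e]]; exists i => //; first by rewrite mem_enum.
  by rewrite inE.
  exact: val_inj.
- apply/forallP => i; apply/implyP => /eqP i0.
  have := rgf_take i.+1 rw; rewrite take_wseqS rgf_rcons i0 take0 /=.
  by rewrite leqn0.
- apply/forallP => i; apply/forallP => i'; apply/implyP => /eqP e.
  have := rgf_take i'.+1 rw; rewrite take_wseqS rgf_rcons => /andP[_].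
  by rewrite e wseq_max // rgf_take.
Qed.

Lemma card_preim_wseq w (j : 'I_n) : #|w @^-1: [set j]| = count_mem (val j) (wseq w).
Proof.
rewrite /wseq count_map cardE size_filter; apply/esym.
rewrite -[enum 'I_n]/(enum (mem 'I_n)) /enum_mem.
by rewrite count_filter; apply: eq_count => i; rewrite !inE /= andbT.
Qed.

Lemma mu_wseq w : mu w = mus (wseq w).
Proof.
rewrite /mu /mus.
have -> : count (fun x => count_mem x (wseq w) == 1) (wseq w) =
  #|[set i | #|w @^-1: [set w i]| == 1]|.
  rewrite /wseq count_map cardE size_filter /enum_mem count_filter.
  by apply: eq_count => i; rewrite !inE /= andbT card_preim_wseq.
have -> : [set j | #|w @^-1: [set j]| == 1] =
    w @: [set i | #|w @^-1: [set w i]| == 1].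
  apply/setP => j; apply/idP/imsetP.
    rewrite inE => cj; case/cards1P: (cj) => i /setP/(_ i).
    rewrite !inE eqxx => /eqP wi; exists i; rewrite ?inE wi //.
  by case=> i; rewrite !inE => ci ->.
apply/card_in_imset => i i'; rewrite !inE => /cards1P[k /setP e] _ eq_w.
have := e i; have := e i'; rewrite !inE eq_w eqxx => /esym/eqP -> /esym/eqP ->.
by [].
Qed.

Lemma itv_eq_set (I : {set 'I_n}) (a b : 'I_n) : I = itv_set a b ->
  a <= b -> (#|I| == 1) || (I == setT) = (a == b) || ((a == 0 :> nat) && (b.+1 == n)).
Proof.
move=> -> ab; congr orb.
  apply/cards1P/eqP => [[k /setP e]|<-].
    have := e a; have := e b; rewrite !inE ab !leqnn /=.
    by move=> /esym/eqP -> /esym/eqP ->.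
  exists a; apply/setP => i; rewrite !inE -eqn_leq eq_sym.
  by apply/eqP/eqP => [/val_inj|->].
have n0 : 0 < n := leq_ltn_trans (leq0n _) (ltn_ord a).
apply/eqP/andP => [/setP e|[/eqP a0 /eqP bn]].
  have n1 : n.-1 < n by rewrite prednK.
  have := e (Ordinal n0); have := e (Ordinal n1); rewrite !inE /=; have := ltn_ord b; lia.
by apply/setP => i; rewrite !inE; have := ltn_ord i; lia.
Qed.

Lemma Hinterval_closed w (a b : 'I_n) : rgf (wseq w) -> a <= b ->
  is_Hinterval w (itv_set a b) <-> closed_itv 0 (wseq w) a b.+1.
Proof.
move=> rw ab; split.
  case/existsP=> a' /existsP[b' /and3P[ab' _ /existsP[c /existsP[d]]]].
  case/andP=> _ /eqP/setP pre; split; rewrite ?size_wseq ?ltnS //.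
  move=> i j si sj; have := nth_wseq w (Ordinal si) => /= ->.
  have := nth_wseq w (Ordinal sj) => /= -> /val_inj wij.
  by have := pre (Ordinal si); have := pre (Ordinal sj); rewrite !inE wij => -> /= <-.
case=> _ _ cl; apply/existsP; exists a; apply/existsP; exists b.
rewrite ab eqxx /=.
have cl' (i j : 'I_n) : w i = w j -> (a <= i <= b) = (a <= j <= b).
  have wl (i' j' : 'I_n) : w i' = w j' -> (a <= i' <= b) -> (a <= j' <= b).
    by move=> e; apply: (cl i' j'); rewrite ?size_wseq ?nth_wseq ?e.
  by move=> e; apply/idP/idP; apply: wl.
(* There are [k] distinct letters before position [a] and [l] up to position [b], so the letters new
   on the interval are those in [k, l): this is the interval of values sought. *)
pose k := size (firsts (take a (wseq w))).
pose l := size (firsts (take b.+1 (wseq w))).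
have rk := rgf_take a rw; have rl := rgf_take b.+1 rw.
have itv_w (i : 'I_n) : (a <= i <= b) = (k <= w i < l).
  apply/idP/idP.
    move=> ai; rewrite leqNgt -mem_rgf // -mem_rgf //; apply/andP; split.
      apply/negP => /mem_take_wseq[j /val_inj /cl' e ja].
      by move: e; rewrite ai leqNgt ja.
    apply/(nthP 0); exists i; last by rewrite nth_take ?nth_wseq // ltnS; case/andP: ai.
    by rewrite size_take_min size_wseq leq_min ltn_ord ltnS; case/andP: ai => _ ->.
  rewrite leqNgt -mem_rgf // -mem_rgf // => /andP[nk /mem_take_wseq[j /val_inj e jb]].
  rewrite (cl' _ _ e) -[j <= b]ltnS jb andbT leqNgt; apply: contra nk => ja.
  apply/(nthP 0); exists j; last by rewrite nth_take ?nth_wseq // e.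
  by rewrite size_take_min size_wseq leq_min ltn_ord ja.
(* The letter at [a] is new by closedness, and a new letter of an RGF is the least one not yet
   used. *)
have wak : val (w a) = k.
  have := itv_w a; rewrite leqnn ab => /esym/andP[ka _].
  apply/eqP; rewrite eqn_leq ka andbT.
  by have := rgf_take a.+1 rw; rewrite take_wseqS rgf_rcons => /andP[].
have kl : k < l by have := itv_w a; rewrite leqnn ab wak => /esym/andP[].
(* The position [d] carries the largest letter [l.-1]; thus [w a] and [w d] are the ends of the
   interval of values. *)
have : l.-1 \in take b.+1 (wseq w) by rewrite mem_rgf // prednK // (leq_ltn_trans _ kl).
case/mem_take_wseq=> d wd db.
have itv_wd v : (w a <= v <= w d) = (k <= v < l).
  by move: wak wd; rewrite /= => -> <-; lia.
apply/existsP; exists (w a); apply/existsP; exists (w d); apply/andP; split.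
  apply/eqP/setP => v; rewrite !inE itv_wd; apply/imsetP/idP.
    by case=> i; rewrite inE itv_w => hi ->.
  move=> kv; have : val v \in take b.+1 (wseq w) by rewrite mem_rgf //; case/andP: kv.
  case/mem_take_wseq => i /val_inj e ib; exists i => //; by rewrite inE itv_w -e.
by apply/eqP/setP => i; rewrite !inE itv_wd itv_w.
Qed.

Lemma is_simple_rgfP w : is_simple_rgf w = rgf (wseq w) && `[< simple (wseq w) >].
Proof.
rewrite /is_simple_rgf is_rgfP; case rw : (rgf _) => //=.
have cw : is_cayley w by have := is_rgfP w; rewrite rw => /and3P[].
rewrite /is_simple cw /=; apply/forallP/asboolP => [si a b cl|si I].
  have [ab bn _] := cl; rewrite size_wseq in bn *.
  have an := leq_trans ab bn.
  have bn' : b.-1 < n by rewrite prednK // (leq_ltn_trans _ ab).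
  have /= := si (itv_set (Ordinal an) (Ordinal bn')).
  have ab' : (Ordinal an <= Ordinal bn')%N by rewrite /=; lia.
  have -> : is_Hinterval w (itv_set (Ordinal an) (Ordinal bn')).
    by apply/Hinterval_closed => //=; rewrite prednK // (leq_ltn_trans _ ab).
  rewrite (itv_eq_set erefl ab') -val_eqE /=; lia.
apply/implyP => hI; have /existsP[a /existsP[b /and3P[ab /eqP eI _]]] := hI.
rewrite (itv_eq_set eI ab) -val_eqE /=.
rewrite eI in hI; have := si _ _ (proj1 (Hinterval_closed rw ab) hI).
by rewrite size_wseq; lia.
Qed.

End Words.

(** * Restricted growth functions and set partitions *)

Local Open Scope ring_scope.

(** The default letter [i] of [insubd] is never taken for an RGF of length [n], whose letters are
    all below [n]. *)
Definition word_of n (s : seq nat) : word n := [ffun i : 'I_n => insubd i (nth 0%N s i)].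

Lemma wseq_word_of n s : rgf s -> size s = n -> wseq (word_of n s) = s.
Proof.
move=> rs sn; apply: (@eq_from_nth _ 0%N); rewrite size_wseq ?sn // => i i_n.
have := nth_wseq (word_of n s) (Ordinal i_n) => /= ->.
rewrite ffunE insubdK //= unfold_in.
have := mem_nth 0%N (_ : (i < size s)%N); rewrite sn => /(_ i_n).
rewrite mem_rgf // => /leq_trans; apply.
by rewrite size_rev -sn (leq_trans (size_undup _)) // size_rev.
Qed.

Lemma preim_partitionE n (T : eqType) (f : 'I_n -> T) :
  preim_partition f setT = [set [set j | f i == f j] | i in setT].
Proof.
by apply: eq_imset => i; apply/setP => j; rewrite !inE.
Qed.

Lemma eq_preim_partition n (T U : eqType) (f : 'I_n -> T) (g : 'I_n -> U) :
  (forall i j, (f i == f j) = (g i == g j)) ->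
  preim_partition f setT = preim_partition g setT.
Proof.
move=> fg; rewrite !preim_partitionE; apply: eq_imset => i.
by apply/setP => j; rewrite !inE fg.
Qed.

Lemma pblock_preim n (T : eqType) (f : 'I_n -> T) i j :
  (pblock (preim_partition f setT) i == pblock (preim_partition f setT) j) =
  (f i == f j).
Proof.
have PP := preim_partitionP f setT.
rewrite eq_pblock ?(partition_trivIset PP) ?(cover_partition PP) ?inE //.
rewrite pblock_equivalence_partition ?inE //.
by move=> x y z _ _ _; split => // /eqP ->.
Qed.

(** The blocks themselves serve as letters before standardization. *)
Definition word_of_partition n (P : {set {set 'I_n}}) : word n :=
  word_of n (std [seq pblock P i | i <- enum 'I_n]).

Lemma wseq_word_of_partition n (P : {set {set 'I_n}}) :
  wseq (word_of_partition P) = std [seq pblock P i | i <- enum 'I_n].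
Proof.
by rewrite wseq_word_of ?rgf_std // size_std size_map size_enum_ord.
Qed.

Lemma word_of_partition_kernel n (P : {set {set 'I_n}}) i j :
  (word_of_partition P i == word_of_partition P j) = (pblock P i == pblock P j).
Proof.
rewrite -val_eqE /= -!nth_wseq wseq_word_of_partition (std_kernel set0).
- by rewrite !nth_map_enum.
- by rewrite size_map size_enum_ord.
- by rewrite size_map size_enum_ord.
Qed.

Lemma preim_partitionK n (w : word n) : is_rgf w ->
  word_of_partition (preim_partition w setT) = w.
Proof.
rewrite is_rgfP => rw; apply: wseq_inj; rewrite wseq_word_of_partition.
rewrite -[RHS]std_id //; apply: (@eq_std _ _ set0 0%N).
  by rewrite size_wseq size_map size_enum_ord.
move=> i j; rewrite size_map size_enum_ord => i_n j_n.
have := nth_wseq w (Ordinal i_n) => /= ->.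
have := nth_wseq w (Ordinal j_n) => /= ->.
have P := nth_map_enum (pblock (preim_partition w setT)) set0.
have := P (Ordinal i_n); have := P (Ordinal j_n) => /= -> ->.
by rewrite pblock_preim.
Qed.

Definition singleton_weight (R : comNzRingType) (t : R) (k : nat) : R :=
  if k == 1%N then t else 1.

Lemma prod_preim_weight (R : comNzRingType) (t : R) n (w : word n) :
  \prod_(A in preim_partition w setT) singleton_weight t #|A| = t ^+ mu w.
Proof.
rewrite (bigID (fun A : {set 'I_n} => #|A| == 1%N)) /=.
rewrite [X in _ * X]big1 ?mulr1; last first.
  by move=> A /andP[_ /negPf A1]; rewrite /singleton_weight A1.
rewrite (eq_bigr (fun=> t)); last by move=> A /andP[_ A1]; rewrite /singleton_weight A1.
rewrite prodr_const; congr (_ ^+ _); rewrite /mu.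
rewrite -(card_in_imset (f := fun j => w @^-1: [set j])); last first.
  move=> j j'; rewrite !inE => /cards1P[i /setP/(_ i)]; rewrite !inE eqxx.
  by move=> /eqP wi _ /setP/(_ i); rewrite !inE wi eqxx => /esym/eqP.
apply: eq_card => A; rewrite unfold_in preim_partitionE.
have preE x : [set j | w x == w j] = w @^-1: [set w x].
  by apply/setP => j; rewrite !inE eq_sym.
apply/andP/imsetP => [[/imsetP[x _ ->] c1]|[j]].
  by exists (w x); rewrite ?inE -?preE.
rewrite inE => c1 ->; split => //; case/cards1P: (c1) => i /setP/(_ i).
rewrite !inE eqxx => /eqP wi; apply/imsetP; exists i => //.
by rewrite -wi preE.
Qed.

Lemma sum_rgf_bell (R : comNzRingType) (t : R) n :
  \sum_(w : word n | is_rgf w) t ^+ mu w = bell (singleton_weight t) n.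
Proof.
rewrite /bell /part_weight (reindex_onto (@word_of_partition n)
  (fun w => preim_partition w setT)) /=; last exact: preim_partitionK.
apply: eq_big => [P|P /andP[_ /eqP {2}<-]]; last by rewrite prod_preim_weight.
(* Reindexing lets [P] range over all sets of sets; its word is an RGF in any case, and [P] is
   recovered from it exactly when [P] is a partition. *)
rewrite is_rgfP wseq_word_of_partition rgf_std /=.
apply/eqP/idP => [<-|PP]; first exact: preim_partitionP.
rewrite -[RHS](preim_partition_pblock PP).
by apply: eq_preim_partition => i j; rewrite word_of_partition_kernel.
Qed.

Lemma BrgfE n : Brgf n = bell (singleton_weight 'X) n.
Proof. exact: sum_rgf_bell. Qed.

(** A product of 0/1 weights is the indicator that all block sizes satisfy [p]; both kinds of
    Stirling numbers arise in this way. Blocks are nonempty, hence the restriction to positive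
    [k]. *)
Lemma part_weight1 (R : comNzRingType) (w : nat -> R) (p : pred nat) n :
  (forall k, (0 < k)%N -> w k = (p k)%:R) ->
  bell w n = (\sum_(k < n.+1) #|[set P : {set {set 'I_n}} | partition P setT &
     (#|P| == k) && [forall A in P, p #|A|]]|)%:R.
Proof.
move=> wp; rewrite /bell /part_weight.
rewrite (eq_bigr (fun P : {set {set 'I_n}} => ([forall A in P, p #|A|] : nat)%:R)); last first.
  move=> P PP; have card_gt0 A : A \in P -> (0 < #|A|)%N.
    by move=> /(partition_neq0 PP); rewrite card_gt0.
  case: forall_inP => [allp|/forall_inP/forall_inPn[A AP npA]].
    by rewrite big1 // => A AP; rewrite wp ?card_gt0 // allp.
  by rewrite (bigD1 A) //= wp ?card_gt0 // (negPf npA) mul0r.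
rewrite -natr_sum; congr _%:R.
rewrite (partition_big (fun P : {set {set 'I_n}} => inord #|P| : 'I_n.+1) xpredT) //=.
have cP (P : {set {set 'I_n}}) : partition P setT -> (#|P| <= n)%N.
  move=> PP; rewrite -[n in (_ <= n)%N]card_ord -cardsT (card_partition PP).
  rewrite -sum1_card leq_sum // => A AP.
  by rewrite card_gt0 (partition_neq0 PP).
apply: eq_bigr => k _; rewrite -sum1_card [RHS]big_mkcond [LHS]big_mkcond /=.
apply: eq_bigr => P _; rewrite inE.
case PP: (partition P _) => //=; rewrite -val_eqE /= inordK ?ltnS ?cP //.
by case: (_ == _) => //=; case: (\big[_/_]_(_ <- _ | _) _ _) => //; case: ([forall _, _]).
Qed.

Lemma Brgf_stirling n : (1 <= n)%N ->
  Brgf n = \sum_(1 <= k < n.+1) \sum_(0 <= j < k.+1)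
             ('C(n, j) * stirling2 (n - j) (k - j))%:R * ('X - 1) ^+ j.
Proof.
move=> n0; rewrite BrgfE.
(* Here t = 1 + (t - 1): every block has base weight 1, and marked singletons carry t - 1. *)
rewrite (@bell_singleton _ (fun=> 1) _ ('X - 1)); first last.
- by move=> [|[|k]].
- by rewrite /singleton_weight /= addrC subrK.
have bellE m : bell (fun=> 1 : {poly int}) m = \sum_(i < m.+1) (stirling2 m i)%:R.
  rewrite (@part_weight1 _ _ xpredT) // natr_sum; apply: eq_bigr => k _.
  congr _%:R; apply: eq_card => P; rewrite !inE; congr (_ && _).
  by rewrite -[RHS]andbT; congr (_ && _); apply/forall_inP.
transitivity (\sum_(k < n.+1) \sum_(j < n.+1 | (j <= k)%N)
   ('C(n, j) * stirling2 (n - j) (k - j))%:R * ('X - 1) ^+ j : {poly int}).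
  rewrite (exchange_big_dep xpredT) //=; apply: eq_bigr => j _.
  have jn : (j <= n)%N by rewrite -ltnS.
  rewrite bellE mulr_sumr -sumrMnl.
  transitivity (\sum_(0 + j <= k < n.+1) ('C(n, j) * stirling2 (n - j) (k - j))%:R * ('X - 1) ^+ j : {poly int}).
    rewrite big_addn big_mkord subSn //; apply: eq_bigr => i _.
    by rewrite addnK natrM -mulr_natl; ring.
  by rewrite big_geq_mkord.
rewrite -(big_mkord xpredT (fun k => \sum_(j < n.+1 | (j <= k)%N)
   ('C(n, j) * stirling2 (n - j) (k - j))%:R * ('X - 1) ^+ j : {poly int})).
(* The term k = 0 vanishes: a nonempty set has no partition into zero blocks. *)
rewrite big_ltn // big1 ?add0r; last first.
  move=> j; rewrite leqn0 => /eqP ->; rewrite subn0 bin0 mul1n.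
  suff -> : stirling2 n 0 = 0%N by rewrite mul0r.
  apply: eq_card0 => P; rewrite !inE; apply/andP => -[PP]; rewrite cards_eq0 => /eqP P0.
  have := card_partition PP; rewrite P0 big_set0 cardsT card_ord => nz.
  by rewrite nz in n0.
rewrite big_nat_cond [RHS]big_nat_cond; apply: eq_bigr => k /andP[/andP[_ kn] _].
rewrite big_mkord (big_ord_widen_cond n.+1 xpredT (fun j => ('C(n, j) * stirling2 (n - j) (k - j))%:R * ('X - 1) ^+ j)) //.
Qed.

Lemma Brgf_coef n j : (1 <= n)%N -> (j <= n)%N ->
  (Brgf n)`_j =
    ('C(n, j) * \sum_(0 <= i < (n - j).+1) stirling2_ge2 (n - j) i)%N%:Z.
Proof.
move=> n0 jn; rewrite BrgfE.
(* With base weight 0 on singletons and [c] = t, every singleton has to be marked, so the [j]-th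
   term of the convolution is a monomial in t of degree [j]. *)
rewrite (@bell_singleton _ (fun k => (1 < k)%:R) _ 'X); first last.
- by move=> [|[|k]].
- by rewrite /singleton_weight /= add0r.
have bellE m : bell (fun k => (1 < k)%:R : {poly int}) m =
    (\sum_(0 <= i < m.+1) stirling2_ge2 m i)%:R.
  by rewrite (@part_weight1 _ _ (leq 2)) // big_mkord.
rewrite coef_sum (bigD1 (Ordinal (jn : j < n.+1)%N)) //= big1 ?addr0.
  by rewrite bellE -mulrnAr -mulrnA -polyC_natr coefXnM ltnn subnn coefC /= natz mulnC.
move=> i /eqP ij; rewrite bellE -mulrnAr -mulrnA -polyC_natr coefXnM coefC.
case: ltnP => // ji; rewrite subn_eq0 leqNgt ltn_neqAle ji.
have -> // : (i != j :> nat)%N; by apply/eqP => e; apply: ij; apply: val_inj.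
Qed.

(** * The exponential generating function *)

Section PowerSeries.
Variable R : comNzRingType.
Implicit Types f g : fps R.

Lemma fcoef0 n : (0 : fps R) n = 0.
Proof. by case: n. Qed.

Lemma fcoefB f g n : (f - g) n = f n - g n.
Proof. by []. Qed.

Lemma fcoefMn f m n : (f *+ m) n = f n *+ m.
Proof.
by elim: m => [|m IH]; rewrite ?mulr0n ?fcoef0 // !mulrS fcoefD IH.
Qed.

Lemma fcoefCM c f n : (fpsC c * f) n = c * f n.
Proof.
rewrite fcoefM big_ord_recl subn0 big1 ?addr0 // => i _.
by rewrite /= mul0r.
Qed.

Lemma fcoefXnM k f n : (fpsX ^+ k * f) n = if (n < k)%N then 0 else f (n - k)%N.
Proof.
elim: k n => [|k IH] n; first by rewrite expr0 mul1r subn0.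
rewrite exprS -mulrA; move: (fpsX ^+ k * f) IH => g IH.
rewrite fcoefM big_ord_recl /= mul0r add0r.
case: n => [|n]; first by rewrite big_ord0.
rewrite big_ord_recl /= big1 ?addr0 => [|i _]; last by rewrite /= mul0r.
by rewrite mul1r subn1 IH ltnS subSS.
Qed.

Lemma fcoefXn k n : (fpsX ^+ k : fps R) n = (n == k)%:R.
Proof.
rewrite -[fpsX ^+ k]mulr1 fcoefXnM fcoef1 subn_eq0.
by case: ltngtP.
Qed.

Definition fps_deriv f : fps R := Fps (fun n => f n.+1 *+ n.+1).

Lemma fcoef_deriv f n : fps_deriv f n = f n.+1 *+ n.+1. Proof. by []. Qed.

Lemma fps_derivM f g : fps_deriv (f * g) = fps_deriv f * g + f * fps_deriv g.
Proof.
apply: fpsP => n; rewrite fcoefD /= -sumrMnl.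
rewrite (eq_bigr (fun i : 'I_n.+2 => (f i *+ i) * g (n.+1 - i)%N +
    f i * (g (n.+1 - i)%N *+ (n.+1 - i)))); last first.
  move=> i _; have hi := ltn_ord i; rewrite mulrnAl mulrnAr -mulrnDr subnKC //.
rewrite big_split /=; congr (_ + _).
  by rewrite big_ord_recl mulr0n mul0r add0r; apply: eq_bigr => i _.
rewrite big_ord_recr /= subnn mulr0n mulr0 addr0; apply: eq_bigr => i _.
by rewrite subSn // -ltnS.
Qed.

Lemma fps_derivX f k : fps_deriv (f ^+ k.+1) = (fps_deriv f * f ^+ k) *+ k.+1.
Proof.
elim: k => [|k IH]; first by rewrite expr1 expr0 mulr1.
by rewrite exprS fps_derivM IH mulrnAr mulrCA -exprS [RHS]mulrS.
Qed.

End PowerSeries.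

Section Exponential.
Variable A : comAlgType rat.
Implicit Type f : fps A.

Lemma factS_inv k : (k.+1`!%:R^-1 : rat) *+ k.+1 = k`!%:R^-1.
Proof.
by rewrite factS natrM -[LHS]mulr_natr invfM mulrAC mulVf ?mul1r // pnatr_eq0.
Qed.

Lemma fcoef_exp f n : fps_exp f n = \sum_(k < n.+1) (k`!%:R^-1 : rat) *: (f ^+ k) n.
Proof. by apply: eq_bigr => k _; rewrite fcoefCM mulr_algl. Qed.

(** Since [f ^+ k] has order at least [k], the truncation in [fps_exp], which varies with the
    coefficient, can be replaced by a common one. *)
Lemma fcoef_exp_widen f n m : f 0%N = 0 -> (n <= m)%N ->
  fps_exp f n = \sum_(k < m.+1) (k`!%:R^-1 : rat) *: (f ^+ k) n.
Proof.
move=> f0 nm; rewrite fcoef_exp (big_ord_widen m.+1 (fun k => (k`!%:R^-1 : rat) *: (f ^+ k) n)) //.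
rewrite big_mkcond; apply: eq_bigr => k _.
by case: ltnP => // nk; rewrite fcoefX_lt // scaler0.
Qed.

(** Termwise, f^(k+1)/(k+1)! has derivative f' f^k/k!. *)
Lemma fps_deriv_exp f : f 0%N = 0 -> fps_deriv (fps_exp f) = fps_deriv f * fps_exp f.
Proof.
move=> f0; apply: fpsP => n; rewrite fcoefM [LHS]fcoef_deriv.
rewrite fcoef_exp -sumrMnl big_ord_recl expr0 fcoef1 scaler0 mul0rn add0r.
rewrite (eq_bigr (fun k : 'I_n.+1 => (k`!%:R^-1 : rat) *: (fps_deriv f * f ^+ k) n)).
  rewrite [RHS](eq_bigr (fun i : 'I_n.+1 => \sum_(k < n.+1)
      (k`!%:R^-1 : rat) *: (fps_deriv f i * (f ^+ k) (n - i)%N))); last first.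
    move=> i _; rewrite (@fcoef_exp_widen _ _ n) ?leq_subr // mulr_sumr.
    by apply: eq_bigr => k _; rewrite scalerAr.
  rewrite exchange_big; apply: eq_bigr => k _; rewrite fcoefM scaler_sumr.
  by [].
move=> k _; rewrite scalerMnr -[_ *+ n.+1]/(fps_deriv (f ^+ (bump 0 k)) n).
by rewrite fps_derivX fcoefMn -scalerMnr scalerMnl factS_inv.
Qed.

Lemma fcoef_exp0 f : fps_exp f 0%N = 1.
Proof. by rewrite fcoef_exp big_ord1 expr0 fcoef1 invr1 scale1r. Qed.

Lemma fcoef_expX n : fps_exp (fpsX : fps A) n = (n`!%:R^-1 : rat)%:A.
Proof.
rewrite fcoef_exp (bigD1 ord_max) //= big1 ?addr0 => [|i /eqP ni]; rewrite fcoefXn ?eqxx //.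
have /negPf -> : n != i by apply/eqP => e; apply: ni; apply: val_inj.
by rewrite scaler0.
Qed.

End Exponential.

Lemma Brgf_egfE :
  Brgf_egf = fps_exp (fpsC 'X * fpsX + fps_exp fpsX - 1 - fpsX).
Proof.
set f := (X in fps_exp X).
pose w := singleton_weight ('X : {poly rat}).
have BE n : map_poly intr (Brgf n) = bell w n :> {poly rat}.
  rewrite -sum_rgf_bell /Brgf rmorph_sum; apply: eq_bigr => v _.
  by rewrite rmorphXn /= map_polyX.
have GE n : Brgf_egf n = (n`!%:R^-1 : rat) *: bell w n.
  rewrite fcoefD fcoef1; case: n => [|n] /=.
    by rewrite bell0 addr0 invr1 scale1r.
  by rewrite add0r BE.
(* The exponent is the sum of w(k) z^k/k! over k >= 1, so the coefficients of its derivative are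
   those of the recursion [bellS]. *)
have fE k : f k.+1 *+ k.+1 = (k`!%:R^-1 : rat) *: w k.+1.
  rewrite /f !fcoefB fcoefD fcoefCM fcoef_expX fcoef1 -[fpsX]expr1 !fcoefXn.
  case: k => [|k] /=.
    by rewrite /w /singleton_weight /= mulr1 invr1 !scale1r subr0 addrK.
  by rewrite mulr0 add0r !subr0 scalerMnl factS_inv.
have f0 : f 0%N = 0.
  rewrite /f !fcoefB fcoefD fcoefCM fcoef_expX fcoef1 /=.
  by rewrite mulr0 add0r invr1 scale1r subr0 subrr.
apply: fpsP; elim/ltn_ind => -[|n] IH.
  by rewrite GE fcoef_exp0 bell0 invr1 scale1r.
have := congr1 (fun g : fps {poly rat} => g n) (fps_deriv_exp f0).
rewrite fcoefM [LHS]fcoef_deriv => e.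
(* The differential equation gives n+1 times the next coefficient; over the rationals the factor can
   be cancelled. *)
have n1 : (n.+1%:R : rat) != 0 by rewrite pnatr_eq0.
apply: (scalerI n1); rewrite !scaler_nat e GE.
rewrite scalerMnl factS_inv bellS scaler_sumr; apply: eq_bigr => i _.
have i_n : (i <= n)%N by rewrite -ltnS.
rewrite -IH ?ltnS ?leq_subr // GE [fps_deriv f i]fE.
rewrite -scalerAl -scalerAr scalerA -scaler_nat scalerA; congr (_ *: _).
rewrite -(bin_fact i_n) !natrM; field.
by rewrite !pnatr_eq0 -!lt0n !fact_gt0 bin_gt0 i_n.
Qed.

(** * Inflations and closed intervals *)

Local Open Scope nat_scope.

Definition starts (c : seq nat) k := sumn (take k c).

Lemma starts0 c : starts c 0 = 0.
Proof. by rewrite /starts take0. Qed.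

Lemma startsS c k : starts c k.+1 = starts c k + nth 0 c k.
Proof.
rewrite /starts; case: (ltnP k (size c)) => kc.
  by rewrite (take_nth 0) // -cats1 sumn_cat /= addn0.
by rewrite nth_default // !take_oversize // ?addn0 // ltnW.
Qed.

Lemma starts_size c : starts c (size c) = sumn c.
Proof. by rewrite /starts take_size. Qed.

Lemma leq_starts c k l : k <= l -> starts c k <= starts c l.
Proof.
move=> /subnKC <-; elim: (l - k) => [|d IH]; first by rewrite addn0.
by rewrite addnS startsS (leq_trans IH) // leq_addr.
Qed.

Lemma starts_leS c k l : k < l -> starts c k + nth 0 c k <= starts c l.
Proof. by rewrite -startsS; apply: leq_starts. Qed.

Lemma starts_find c i : i < sumn c ->
  exists k j, [/\ k < size c, j < nth 0 c k & i = starts c k + j].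
Proof.
move=> ic; exists (reshape_index c i), (reshape_offset c i).
by rewrite reshape_indexP // reshape_offsetP // -{1}[i](@reshape_indexK c).
Qed.

Lemma nth_shape (ss : seq (seq nat)) k : nth 0 (shape ss) k = size (nth [::] ss k).
Proof.
case: (ltnP k (size ss)) => kc; first by rewrite (nth_map [::]).
by rewrite !nth_default ?size_map.
Qed.

Lemma starts_le_sum c k : starts c k <= sumn c.
Proof.
case: (leqP k (size c)) => kc; first by rewrite -starts_size leq_starts.
by rewrite /starts take_oversize // ltnW.
Qed.

(** The complement of a union of level sets is again one. *)
Lemma closed_split (s : seq nat) a b : closed_itv 0 s a b -> b < size s -> a = 0 ->
  closed_itv 0 s b (size s).
Proof.
move=> [ab bs cl] bn a0; split => // i j si sj e /andP[bi _]; rewrite sj andbT.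
rewrite leqNgt; apply/negP => jb; have := cl j i sj si (esym e).
by rewrite a0 jb /= ltnNge bi => /(_ isT).
Qed.

Lemma closed_split0 (s : seq nat) b : closed_itv 0 s b (size s) -> 0 < b -> closed_itv 0 s 0 b.
Proof.
move=> [ab bs cl] bn; split => // [|i j si sj e /andP[_ bi]]; first exact: ltnW.
rewrite leq0n ltnNge; apply/negP => jb; have := cl j i sj si (esym e).
by rewrite jb sj leqNgt bi => /(_ isT).
Qed.

Lemma closedU (s : seq nat) a b c d : closed_itv 0 s a b -> closed_itv 0 s c d ->
  a <= c -> c < b -> b <= d -> closed_itv 0 s a d.
Proof.
move=> [ab bs cl] [cd ds cl'] ac cb bd; split => //; first by lia.
move=> i j si sj e h; have := cl i j si sj e; have := cl' i j si sj e; lia.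
Qed.

(* The equalities between letters of [w] are those of the word obtained from  *)
(* [sg] by replacing its k-th letter by a copy of the k-th word of [ss], on    *)
(* fresh letters for each letter of [sg].                                      *)
Record inflates (w sg : seq nat) (ss : seq (seq nat)) : Prop := Inflates {
  infl_size : size ss = size sg;
  infl_sum : size w = sumn (shape ss);
  infl_gt0 : forall k, k < size sg -> 0 < size (nth [::] ss k);
  infl_single : forall k l, k < size sg -> l < size sg -> k != l ->
    nth 0 sg k = nth 0 sg l -> size (nth [::] ss k) = 1;
  infl_kernel : forall k j l i, k < size sg -> l < size sg ->
    j < size (nth [::] ss k) -> i < size (nth [::] ss l) ->
    (nth 0 w (starts (shape ss) k + j) == nth 0 w (starts (shape ss) l + i)) =
    (nth 0 sg k == nth 0 sg l) &&
      ((k != l) || (nth 0 (nth [::] ss k) j == nth 0 (nth [::] ss l) i)) }.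

Section InflatesTheory.
Variables (w sg : seq nat) (ss : seq (seq nat)).
Hypothesis iw : inflates w sg ss.
Let st := starts (shape ss).
Let c k := size (nth [::] ss k).

Lemma infl_pos i : i < size w ->
  exists k j, [/\ k < size sg, j < c k & i = st k + j].
Proof.
rewrite (infl_sum iw) => /starts_find[k [j []]].
by rewrite size_map (infl_size iw) nth_shape => kc jc ->; exists k, j.
Qed.

Lemma inflS k : st k.+1 = st k + c k.
Proof. by rewrite /st startsS nth_shape. Qed.

Lemma infl_le k l : k < l -> st k + c k <= st l.
Proof. by rewrite -inflS; apply: leq_starts. Qed.

Lemma infl_st_size : st (size sg) = size w.
Proof. by rewrite (infl_sum iw) -(infl_size iw) -(size_map size) /st starts_size. Qed.

Lemma infl_lt k j : k < size sg -> j < c k -> st k + j < size w.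
Proof.
by move=> ks jc; rewrite -infl_st_size (leq_trans _ (infl_le ks)) // ltn_add2l.
Qed.

Lemma infl_st_lt k l : k < l -> k < size sg -> st k < st l.
Proof.
by move=> /infl_le kl /(infl_gt0 iw) c0; rewrite (leq_trans _ kl) // -addn1 leq_add2l.
Qed.

Lemma infl_range k l p j : l <= size sg -> p < size sg -> j < c p ->
  (st k <= st p + j < st l) = (k <= p < l).
Proof.
move=> ls ps jc; apply/idP/idP => /andP[h1 h2]; apply/andP; split.
- by rewrite leqNgt; apply/negP => /infl_le; lia.
- by rewrite ltnNge; apply/negP => /(leq_starts (shape ss)); rewrite -/(st l) -/(st p); lia.
- by have := leq_starts (shape ss) h1; rewrite -/(st k) -/(st p); lia.
- by have := infl_le h2; lia.
Qed.

(** A letter of [sg] occurring once yields a segment whose letters are found in no other segment. *)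
Lemma infl_closed_segment k : k < size sg ->
  (forall l, l < size sg -> nth 0 sg k = nth 0 sg l -> l = k) ->
  closed_itv 0 w (st k) (st k.+1).
Proof.
move=> ks uk; split; first exact: infl_st_lt.
  by rewrite -infl_st_size; apply: leq_starts.
move=> i j /infl_pos[p [x [ps xc ->]]] /infl_pos[q [y [qs yc ->]]] /eqP.
rewrite (infl_kernel iw) // => /andP[/eqP e _]; rewrite !infl_range // => pk.
have pk' : p = k by lia.
by rewrite pk' in e; have := uk _ qs e; lia.
Qed.

Lemma infl_closed_lift k l : closed_itv 0 sg k l -> closed_itv 0 w (st k) (st l).
Proof.
move=> [kl ls cl]; split; first by apply: (infl_st_lt kl); apply: leq_trans kl ls.
  by rewrite -infl_st_size; apply: leq_starts.
move=> i j /infl_pos[p [x [ps xc ->]]] /infl_pos[q [y [qs yc ->]]] /eqP.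
rewrite (infl_kernel iw) // => /andP[/eqP e _]; rewrite !infl_range //.
exact: cl.
Qed.

(* An interval meeting two segments can be enlarged to whole segments, hence   *)
(* projects to a closed interval of [sg], which is everything by simplicity;   *)
(* a partially covered end segment would make [sg] minus one letter closed.    *)
Lemma infl_closed_within a b : simple sg -> 2 < size sg -> closed_itv 0 w a b ->
  (a, b) != (0, size w) ->
  exists2 k, k < size sg & st k <= a /\ b <= st k.+1.
Proof.
move=> si s2 cab; have [ab bw cl] := cab; rewrite xpair_eqE => nab.
have [k [x [ks xc ea]]] := infl_pos (leq_trans ab bw).
have b1w : b.-1 < size w by lia.
have [l [y [ls yc eb]]] := infl_pos b1w.
case: (eqVneq k l) => [kl|kl].
  by exists k => //; rewrite inflS; subst l; lia.
have {}kl : k < l.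
  by rewrite ltn_neqAle kl /= leqNgt; apply/negP => /infl_le; lia.
have un_single p : p < size sg -> 1 < c p ->
    forall q, q < size sg -> nth 0 sg p = nth 0 sg q -> q = p.
  move=> ps cp q qs e; apply/eqP; rewrite eq_sym; apply/negPn/negP => pq.
  by have := infl_single iw ps qs pq e; rewrite -/(c p); lia.
(* If the letter at [p] is repeated, its segment is a single position, hence lies in [a, b) even
   when [p] is one of the ends [k], [l]. *)
have in_itv p q : p < size sg -> k <= p <= l -> q < size sg -> p != q ->
    nth 0 sg p = nth 0 sg q -> a <= st p < b.
  move=> ps pkl qs pq e.
  have cp : c p = 1 := infl_single iw ps qs pq e.
  have h1 : k = p -> st k = st p by move=> ->.
  have h2 : k = p -> c k = c p by move=> ->.
  have h3 : k < p -> st k + c k <= st p by apply: infl_le.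
  have h4 : p = l -> st l = st p by move=> ->.
  have h5 : p < l -> st p + c p <= st l by apply: infl_le.
  lia.
have cover q : q < size sg -> a <= st q < b -> k <= q < l.+1.
  move=> qs h; have h1 : q < k -> st q + c q <= st k by apply: infl_le.
  have h2 : l < q -> st l + c l <= st q by apply: infl_le.
  have := infl_gt0 iw qs; rewrite -/(c q); lia.
have clkl : closed_itv 0 sg k l.+1.
  split; [lia|by []|] => p q ps qs e pkl.
  case: (eqVneq p q) => [<- //|pq]; apply: cover => //.
  have h1 := in_itv p q ps pkl qs pq e.
  have cp := infl_gt0 iw ps; have cq := infl_gt0 iw qs.
  have cp1 := infl_single iw ps qs pq e.
  have e' := esym e; have cq1 := infl_single iw qs ps (_ : q != p) e'.
  rewrite eq_sym in cq1; have {}cq1 := cq1 pq.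
  apply: (cl (st p) (st q)) => //.
  - by have := infl_lt ps cp; lia.
  - by have := infl_lt qs cq; lia.
  have := infl_kernel iw ps qs cp cq; rewrite !addn0 e eqxx pq /=.
  by move=> /eqP.
have [|[k0 lm]] := si _ _ clkl; first by lia.
have st0 : st 0 = 0 by apply: starts0.
have m0 : 0 < size sg by lia.
(* Otherwise the first segment is only partly covered, so it is longer than 1 and its letter is not
   repeated; the rest of [sg] is then closed, against simplicity in length at least 3. *)
have a0 : a = 0.
  apply/eqP/negPn/negP => a0.
  have c0 : 1 < c 0 by subst k; lia.
  have cl1 : closed_itv 0 sg 1 (size sg).
    split; [lia|by []|] => i j i_s js e h; rewrite js andbT lt0n.
    by apply/negP => /eqP j0; subst j; have := un_single _ m0 c0 _ i_s (esym e); lia.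
  by have := si _ _ cl1; lia.
have bn : b < size w by lia.
have cl1 : 1 < c l.
  have := infl_st_size; rewrite -lm inflS; lia.
have cl0 : closed_itv 0 sg 0 l.
  split; [lia|lia|] => i j i_s js e h.
  have : j != l by apply/eqP => jl; subst j; have := un_single _ ls cl1 _ i_s (esym e); lia.
  lia.
by have := si _ _ cl0; lia.
Qed.

Lemma infl_leq_st k l : k < size sg -> l <= size sg -> (st l <= st k) = (l <= k).
Proof.
move=> ks ls; apply/idP/idP; last exact: leq_starts.
by rewrite leqNgt => h; rewrite leqNgt; apply: contra h => /infl_st_lt; apply.
Qed.

Lemma infl_size_le : size sg <= size w.
Proof.
rewrite -infl_st_size; have : forall k, k <= size sg -> k <= st k; last exact.
elim=> // k IH ks; apply: leq_ltn_trans (IH (ltnW ks)) _.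
exact: infl_st_lt.
Qed.

(** A closed proper prefix and its complement would each lie in one segment, leaving at most two
    letters for [sg]. *)
Lemma infl_indec : simple sg -> 2 < size sg -> ~ decomp w.
Proof.
move=> si s2 [b /andP[b0 bw] cl].
have st0 : st 0 = 0 := starts0 _.
have h0 : (0, b) != (0, size w) by rewrite xpair_eqE /= ltn_eqF.
have [k ks [k0 bk]] := infl_closed_within si s2 cl h0.
have cl' := closed_split cl bw erefl.
have h1 : (b, size w) != (0, size w) by rewrite xpair_eqE eqxx andbT -lt0n.
have [l ls [lb nl]] := infl_closed_within si s2 cl' h1.
have {k0} k0 : k = 0.
  by apply/eqP; rewrite -leqn0 -(infl_leq_st _ (ltnW ks)) ?st0 // (leq_trans _ s2).
subst k; have : st l <= st 1 by apply: leq_trans lb bk.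
rewrite infl_leq_st ?(ltnW ls) //; last exact: leq_trans s2.
move=> l1; have : st l.+1 < st (size sg) by apply: infl_st_lt; lia.
by rewrite infl_st_size; lia.
Qed.

End InflatesTheory.

(** A segment longer than 1 is a proper closed interval, so it fits into one segment of the other
    decomposition; the common start makes that the [k]-th one. Used in both directions, this forces
    equal lengths. *)
Lemma infl_segment_le w sg ss sg' ss' k :
  inflates w sg ss -> inflates w sg' ss' -> simple sg -> 2 < size sg -> 2 < size sg' ->
  k < size sg -> k < size sg' -> starts (shape ss) k = starts (shape ss') k ->
  size (nth [::] ss' k) <= size (nth [::] ss k).
Proof.
move=> iw iw' si s2 s2' ks ks' est.
case: (leqP (size (nth [::] ss' k)) 1) => [c1|c1].
  by apply: leq_trans c1 _; apply: infl_gt0 iw _ ks.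
have cl : closed_itv 0 w (starts (shape ss') k) (starts (shape ss') k.+1).
  apply: (infl_closed_segment iw' ks') => l ls e; apply/eqP; rewrite eq_sym.
  by apply/negPn/negP => kl; move: c1; rewrite (infl_single iw' ks' ls kl e).
have [|l ls [lk kl]] := infl_closed_within iw si s2 cl.
  rewrite xpair_eqE negb_and; case: (posnP k) => k0.
    apply/orP; right; rewrite ltn_eqF // -(infl_st_size iw').
    by apply: (infl_st_lt iw') => //; lia.
  by apply/orP; left; rewrite -lt0n -(starts0 (shape ss')) (infl_st_lt iw') //; lia.
move: lk kl; rewrite -est (infl_leq_st iw) ?(ltnW ls) // !inflS -est => lk kl.
suff e : l = k by subst l; lia.
apply/eqP; rewrite eqn_leq lk leqNgt; apply/negP => /infl_le - /(_ ss).
by have := infl_gt0 iw' ks'; lia.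
Qed.

Lemma infl_inj w sg ss sg' ss' :
  inflates w sg ss -> inflates w sg' ss' -> simple sg -> simple sg' ->
  2 < size sg -> 2 < size sg' -> rgf sg -> rgf sg' ->
  (forall k, k < size sg -> rgf (nth [::] ss k)) ->
  (forall k, k < size sg' -> rgf (nth [::] ss' k)) ->
  sg = sg' /\ ss = ss'.
Proof.
move=> iw iw' si si' s2 s2' rs rs' rss rss'.
have ec k : k < size sg -> k < size sg' -> starts (shape ss) k = starts (shape ss') k ->
    size (nth [::] ss k) = size (nth [::] ss' k).
  move=> ks ks' e; apply/eqP; rewrite eqn_leq.
  by rewrite (infl_segment_le iw' iw) // (infl_segment_le iw iw').
(* Equal starts give equal lengths by [ec], and these give the next equal starts. *)
have est k : k <= size sg -> k <= size sg' -> starts (shape ss) k = starts (shape ss') k.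
  elim: k => [|k IH] ks ks'; first by rewrite !starts0.
  by rewrite !inflS IH ?(ltnW ks) ?(ltnW ks') // ec // IH ?(ltnW ks) ?(ltnW ks').
have es : size sg = size sg'.
  case: (ltngtP (size sg) (size sg')) => // h.
    have := infl_st_lt iw' h h; rewrite (infl_st_size iw') -est ?(ltnW h) //.
    by rewrite (infl_st_size iw) ltnn.
  have := infl_st_lt iw h h; rewrite (infl_st_size iw) est ?(ltnW h) //.
  by rewrite (infl_st_size iw') ltnn.
have {}est k : k < size sg -> starts (shape ss) k = starts (shape ss') k.
  by move=> ks; apply: est; rewrite -?es ltnW.
have {}ec k : k < size sg -> size (nth [::] ss k) = size (nth [::] ss' k).
  by move=> ks; apply: ec; rewrite -?es // est.
split.
  (* Letters of [sg] at different places compare like the first letters of their segments in [w]. *)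
  apply: rgf_inj => // k l ks ls; case: (eqVneq k l) => [->|kl]; first by rewrite !eqxx.
  have ck := infl_gt0 iw ks; have cl := infl_gt0 iw ls.
  have := infl_kernel iw ks ls ck cl; rewrite kl andbT => <-.
  rewrite !est // (infl_kernel iw') -?es -?ec // kl andbT.
  by [].
apply: (@eq_from_nth _ [::]); rewrite (infl_size iw) ?(infl_size iw') // => k ks.
have ks' : k < size sg' by rewrite -es.
apply: rgf_inj; rewrite ?rss ?rss' ?ec // => i j ic jc.
have ic' : i < size (nth [::] ss k) by rewrite ec.
have jc' : j < size (nth [::] ss k) by rewrite ec.
have := infl_kernel iw ks ks ic' jc'; rewrite !eqxx /= => <-.
by rewrite !est // (infl_kernel iw') // !eqxx.
Qed.

(** Iterating [e] from [p] lands exactly on [n], since each jump advances and none passes [n]; the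
    composition consists of the jump lengths. *)
Lemma composition_of_steps n (e : nat -> nat) :
  (forall p, p < e p) -> (forall p, p < n -> e p <= n) ->
  forall p, p <= n -> exists c : seq nat, p + sumn c = n /\
    forall k, k < size c ->
      0 < nth 0 c k /\ p + starts c k.+1 = e (p + starts c k).
Proof.
move=> e_gt e_le p; have [d] := ubnP (n - p); elim: d p => // d IH p nd pn.
case: (eqVneq p n) => [->|pn']; first by exists [::]; rewrite addn0.
have {pn'} pn' : p < n by rewrite ltn_neqAle pn'.
have [||c [sc cP]] := IH (e p); [have := e_gt p; lia | exact: e_le |].
exists ((e p - p) :: c); split => [|[|k] kc].
- by rewrite /= addnA subnKC // ltnW.
- by rewrite /= /starts /= take0 /= !addn0 subn_gt0 subnKC // ltnW.
have [? eq] := cP k kc; split => //.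
by rewrite /starts /= !addnA subnKC ?(ltnW (e_gt p)).
Qed.

(** * Existence of the inflation decomposition *)

Section Decomposition.
Variable w : seq nat.
Hypothesis w_indec : ~ decomp w.
Let n := size w.
Let proper a b := closed_itv 0 w a b /\ (a, b) <> (0, n).

Lemma proper_longest : exists e : nat -> nat, forall p,
  [/\ p < e p, p < n -> e p <= n, forall b, proper p b -> b <= e p
    & p.+1 < e p -> proper p (e p)].
Proof.
suff H : forall p, exists q, [/\ p < q, p < n -> q <= n,
    forall b, proper p b -> b <= q & p.+1 < q -> proper p q].
  by have [e eP] := boolp.choice H; exists e.
move=> p.
case: (pselect (exists b, `[< proper p b >])) => [ex|nex]; last first.
  (* Without a proper closed interval at [p] the jump defaults to one position, and the last clause
     is vacuous. *)
  exists p.+1; split => // [b pb|]; last by rewrite ltnn.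
  by case: nex; exists b; apply/asboolP.
have ub b : `[< proper p b >] -> b <= n by move=> /asboolP[[]].
case: (ex_maxnP ex ub) => b /asboolP pb bmax; exists b.
have [[pb' bn _] _] := pb; split => // b' pb2; apply: bmax; exact/asboolP.
Qed.

(* From the start of a segment, jump to the end of the longest proper closed   *)
(* interval starting there, or move by one position if there is none.          *)
Lemma greedy_segments : exists c : seq nat,
  [/\ sumn c = n,
      forall k, k < size c -> 0 < nth 0 c k,
      forall k, k < size c -> 1 < nth 0 c k -> proper (starts c k) (starts c k.+1)
    & forall a b, proper a b -> exists2 k, k < size c &
        starts c k <= a /\ b <= starts c k.+1].
Proof.
have [e eP] := proper_longest.
have [||c [sc cP]] := @composition_of_steps n e _ _ 0 (leq0n _).
- by move=> p; have [] := eP p.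
- by move=> p; have [] := eP p.
have eS k : k < size c -> starts c k.+1 = e (starts c k).
  by move=> /cP[_]; rewrite !add0n.
exists c; split => // [k /cP[]//|k kc c1|a b pab].
  have [_ _ _] := eP (starts c k); rewrite -eS // startsS; apply; lia.
have [[ab bn _] nab] := pab.
have := @starts_find c a; rewrite (_ : sumn c = n) // => /(_ (leq_trans ab bn)).
case=> k [j [kc jc ea]]; exists k => //; split; first lia.
(* If [a, b) left its segment, its union with the segment would be a longer proper closed interval
   with the same start. *)
rewrite leqNgt; apply/negP => sb.
have [_ _ e_max e_proper] := eP (starts c k).
case: (ltnP 1 (nth 0 c k)) => c1; last first.
  have a_st : a = starts c k by lia.
  by rewrite a_st in pab; have := e_max _ pab; rewrite -eS //; lia.
have [cl nfull] : proper (starts c k) (starts c k.+1).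
  by rewrite eS //; apply: e_proper; rewrite -eS // startsS; lia.
have h1 : starts c k <= a by lia.
have h2 : a < starts c k.+1 by rewrite startsS; lia.
have clU := closedU cl pab.1 h1 h2 (ltnW sb).
suff pU : proper (starts c k) b by have := e_max _ pU; rewrite -eS //; lia.
(* A union equal to the whole word would make the segment a closed proper prefix. *)
split => // -[st0 bn']; apply: w_indec; exists (starts c k.+1).
  by rewrite -/n -bn' sb (leq_ltn_trans (leq0n _) h2).
by rewrite st0 in cl.
Qed.

Lemma indec_inflates : 2 < size w -> exists sg ss,
  [/\ inflates w sg ss, rgf sg, simple sg, 2 < size sg
    & forall k, k < size sg -> rgf (nth [::] ss k)].
Proof.
move=> w2; have [c [sc c0 cseg cmax]] := greedy_segments.
pose m := size c; pose st := starts c.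
have cw : size w = sumn c by rewrite sc.
have st_lt k l : k < l -> k < m -> st k < st l.
  by move=> kl km; have := starts_leS c kl; have := c0 _ km; rewrite -/(st k) -/(st l); lia.
have stS k : st k.+1 = st k + nth 0 c k := startsS c k.
have stm : st m = size w by rewrite /st /m starts_size.
have st_in k j : k < m -> j < nth 0 c k -> st k + j < size w.
  by move=> km jc; rewrite -stm; have := starts_leS c km; rewrite -/(st k) -/(st m); lia.
(* First letters are enough to define the outer word: by [sep] below, a letter shared by two
   segments forces both to have length 1. *)
pose heads := mkseq (fun k => nth 0 w (st k)) m.
pose sg := std heads.
pose ss := [seq std s | s <- reshape c w].
have size_sg : size sg = m by rewrite size_std size_mkseq.
have shape_ss : shape ss = c.
  rewrite /shape -map_comp (eq_map (g := size)); last by move=> s /=; rewrite size_std.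
  by apply: reshapeKl; rewrite cw.
have size_ss : size ss = m by rewrite size_map size_reshape.
have sz k : size (nth [::] ss k) = nth 0 c k by rewrite -nth_shape shape_ss.
have nth_seg k j : j < nth 0 c k -> nth 0 (nth [::] (reshape c w) k) j = nth 0 w (st k + j).
  by move=> jc; rewrite nth_reshape nth_take // nth_drop.
have size_seg k : k < m -> size (nth [::] (reshape c w) k) = nth 0 c k.
  by move=> km; rewrite -sz (nth_map [::]) ?size_std // size_reshape.
have sg_kernel k l : k < m -> l < m ->
    (nth 0 sg k == nth 0 sg l) = (nth 0 w (st k) == nth 0 w (st l)).
  by move=> km lm; rewrite (std_kernel 0) ?size_mkseq // !nth_mkseq.
have ss_kernel k i j : k < m -> i < nth 0 c k -> j < nth 0 c k ->
    (nth 0 (nth [::] ss k) i == nth 0 (nth [::] ss k) j) =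
    (nth 0 w (st k + i) == nth 0 w (st k + j)).
  move=> km ic jc; rewrite (nth_map [::]); last by rewrite size_reshape.
  by rewrite (std_kernel 0) ?size_seg // !nth_seg.
have sep k l j i : k < m -> l < m -> j < nth 0 c k -> i < nth 0 c l -> k != l ->
    nth 0 w (st k + j) = nth 0 w (st l + i) -> nth 0 c k = 1.
  move=> km lm jc ic kl e; apply/eqP; rewrite eqn_leq c0 // andbT leqNgt.
  apply/negP => c1; have [[_ _ cl] _] := cseg _ km c1.
  have := cl _ _ (st_in _ _ km jc) (st_in _ _ lm ic) e.
  rewrite -/(st k) -/(st k.+1) leq_addr stS ltn_add2l jc => /(_ isT).
  case: (ltngtP k l) kl => // h _.
    by have := starts_leS c h; rewrite -/(st k) -/(st l); lia.
  by have := starts_leS c h; rewrite -/(st k) -/(st l); lia.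
have iw : inflates w sg ss.
  split; rewrite ?size_sg ?size_ss ?shape_ss //.
  - by move=> k km; rewrite sz c0.
  - move=> k l km lm kl /eqP; rewrite sg_kernel // sz => /eqP e.
    by apply: (@sep k l 0 0); rewrite ?c0 // !addn0.
  move=> k j l i km lm; rewrite !sz sg_kernel // -/(st k) -/(st l) => jc ic.
  case: (eqVneq k l) => [kl|kl]; first by subst l; rewrite eqxx ss_kernel.
  have lk : l != k by rewrite eq_sym.
  rewrite andbT; apply/eqP/eqP => e.
    have ck := sep _ _ _ _ km lm jc ic kl e.
    have cl := sep _ _ _ _ lm km ic jc lk (esym e).
    have j0 : j = 0 by lia.
    have i0 : i = 0 by lia.
    by move: e; rewrite j0 i0 !addn0.
  have e' : nth 0 w (st k + 0) = nth 0 w (st l + 0) by rewrite !addn0.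
  have ck := sep _ _ _ _ km lm (c0 _ km) (c0 _ lm) kl e'.
  have cl := sep _ _ _ _ lm km (c0 _ lm) (c0 _ km) lk (esym e').
  have j0 : j = 0 by lia.
  have i0 : i = 0 by lia.
  by rewrite j0 i0.
exists sg, ss; split => //; rewrite ?rgf_std //.
(* A closed interval of [sg] lifts to [w], where it is everything or lies in one segment; in the
   latter case it had a single letter. *)
- move=> a b clab; have [ab bm _] := clab; rewrite size_sg in bm *.
  have := infl_closed_lift iw clab; rewrite shape_ss -/(st a) -/(st b) => clst.
  case: (pselect ((st a, st b) = (0, n))) => [[sa sb]|np].
    right; split; apply/eqP.
      rewrite -leqn0 leqNgt; apply/negP => a0.
      by have := st_lt 0 a a0; rewrite sa /m; lia.
    rewrite eqn_leq bm leqNgt; apply/negP => bm'.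
    by have := st_lt b m bm' bm'; rewrite sb stm ltnn.
  left; have [k kc [ka bk]] := cmax _ _ (conj clst np).
  have : k <= a by rewrite leqNgt; apply/negP => h; have := st_lt _ _ h (leq_trans ab bm); rewrite -/(st k) in ka; lia.
  have : b <= k.+1 by rewrite leqNgt; apply/negP => h; have := st_lt _ _ h (leq_trans h bm); rewrite -/(st k.+1) in bk; lia.
  lia.
(* If there were at most two segments, one would be longer than 1 since [w] has length at least 3;
   being a closed proper prefix or suffix, it would make [w] decomposable. *)
- rewrite size_sg ltnNge; apply/negP => m2.
  have st0 : st 0 = 0 := starts0 c.
  case: (posnP m) => m0; first by move: stm; rewrite m0 st0; lia.
  have st1 : st 1 = nth 0 c 0 by rewrite /st startsS starts0.
  case: (ltnP 1 (nth 0 c 0)) => c1.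
    have [cl nf] := cseg _ m0 c1; apply: w_indec; exists (st 1); last by rewrite starts0 in cl.
    rewrite -{1}st0 st_lt //= ltn_neqAle -{2}stm leq_starts // andbT.
    by apply/eqP => e; apply: nf; rewrite -/(st 0) -/(st 1) st0 e.
  have m2' : m = 2 by apply/eqP; rewrite eqn_leq m2 ltnNge; apply/negP => m1; move: stm; rewrite (_ : m = 1); lia.
  have st2 : st 2 = size w by rewrite -m2'.
  have c1' : 1 < nth 0 c 1 by move: st2; rewrite /st startsS -/(st 1) st1; lia.
  have m1 : 1 < m by rewrite m2'.
  have [cl _] := cseg 1 m1 c1'.
  rewrite -/(st 1) -/(st 2) st2 in cl.
  have s1 : 0 < st 1 by rewrite st1 c0.
  apply: w_indec; exists (st 1); last exact: closed_split0 cl s1.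
  by rewrite s1 -st2 st_lt // -/m m2'.
move=> k; rewrite size_sg => km; rewrite (nth_map [::]) ?rgf_std //.
by rewrite size_reshape.
Qed.

End Decomposition.

(** * Inflated words *)

Lemma count_mem1P (s : seq nat) k : k < size s ->
  reflect (forall l, l < size s -> nth 0 s l = nth 0 s k -> l = k)
          (count_mem (nth 0 s k) s == 1).
Proof.
move=> ks; set x := nth 0 s k.
have -> : count_mem x s = count_mem x (take k s) + count_mem x (drop k.+1 s) + 1.
  by rewrite -{1}(cat_take_drop k s) count_cat (drop_nth 0) //= eqxx; lia.
rewrite addn1 eqSS addn_eq0 !eqn0Ngt -!has_count !has_pred1.
apply: (iffP andP) => [[nt nd] l ls e|uk].
  case: (ltngtP l k) => // h.
    case/negP: nt; rewrite -e; apply/(nthP 0); exists l.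
      by rewrite size_take_min leq_min h ls.
    by rewrite nth_take.
  case/negP: nd; rewrite -e; apply/(nthP 0); exists (l - k.+1).
    by rewrite size_drop ltn_sub2r // (leq_ltn_trans h ls).
  by rewrite nth_drop subnKC.
split; apply/(nthP 0) => -[l].
  rewrite size_take_min leq_min => /andP[lk ls]; rewrite nth_take // => e.
  by have := uk _ ls e; lia.
rewrite size_drop nth_drop => ls e.
have ls' : k.+1 + l < size s by rewrite -ltn_subRL.
by have := uk _ ls' e; lia.
Qed.

Section Inflation.
Variables (sg : seq nat) (ss : seq (seq nat)).

(** Pairing with the letter of [sg] keeps the words inserted at distinct letters on disjoint
    alphabets. *)
Definition pairs_word : seq (nat * nat) :=
  flatten [seq [seq (p.1, b) | b <- p.2] | p <- zip sg ss].

Definition inflate : seq nat := std pairs_word.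

Hypothesis size_ss : size ss = size sg.

Let segs := [seq [seq (p.1, b) | b <- p.2] | p <- zip sg ss].

Lemma shape_segs : shape segs = shape ss.
Proof.
rewrite /shape -map_comp; transitivity [seq size p.2 | p <- zip sg ss].
  by apply: eq_map => p /=; rewrite size_map.
by rewrite -{2}(@unzip2_zip _ _ sg ss) ?size_ss // /unzip2 -map_comp.
Qed.

Lemma size_pairs_word : size pairs_word = sumn (shape ss).
Proof. by rewrite size_flatten -/segs shape_segs. Qed.

Lemma nth_pairs_word k j : k < size sg -> j < size (nth [::] ss k) ->
  nth (0, 0) pairs_word (starts (shape ss) k + j) =
  (nth 0 sg k, nth 0 (nth [::] ss k) j).
Proof.
move=> ks jc; rewrite nth_flatten -/segs shape_segs -/(flatten_index (shape ss) k j).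
rewrite flatten_indexKl ?flatten_indexKr ?nth_shape //.
rewrite (nth_map (0, [::])) ?size_zip ?size_ss ?minnn // nth_zip //=.
by rewrite (nth_map 0).
Qed.

Hypothesis ss_gt0 : forall k, k < size sg -> 0 < size (nth [::] ss k).
Hypothesis ss_single : forall k, k < size sg ->
  count_mem (nth 0 sg k) sg != 1 -> nth [::] ss k = [:: 0].

Lemma inflates_inflate : inflates inflate sg ss.
Proof.
have lt k j : k < size sg -> j < size (nth [::] ss k) ->
    starts (shape ss) k + j < size pairs_word.
  move=> ks jc; rewrite size_pairs_word -nth_shape in jc *.
  rewrite (leq_trans _ (starts_le_sum _ k.+1)) // startsS ltn_add2l //.
split=> //; first by rewrite size_std size_pairs_word.
- move=> k l ks ls kl e; rewrite ss_single //; apply/negP => /(count_mem1P ks).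
  by move=> /(_ _ ls (esym e)) lk; rewrite lk eqxx in kl.
move=> k j l i ks ls jc ic; rewrite (std_kernel (0, 0)) ?lt //.
rewrite !nth_pairs_word // xpair_eqE.
case: (eqVneq k l) => [->|kl] //=; rewrite andbT.
case: eqP => //= e.
(* Two places carry the same letter of [sg], so both inserted words are [[:: 0]] and the inner
   letters agree. *)
rewrite ss_single //; last first.
  by apply/negP => /(count_mem1P ks)/(_ _ ls (esym e)) lk; rewrite lk eqxx in kl.
rewrite ss_single // in ic *; last first.
  by apply/negP => /(count_mem1P ls)/(_ _ ks e) lk; rewrite lk eqxx in kl.
rewrite ss_single // in jc *; last first.
  by apply/negP => /(count_mem1P ks)/(_ _ ls (esym e)) lk; rewrite lk eqxx in kl.
by case: j i jc ic => [|j] [|i].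
Qed.

Lemma count_pairs_word (P : pred (nat * nat)) : count P pairs_word =
  \sum_(k < size sg) count (fun b => P (nth 0 sg k, b)) (nth [::] ss k).
Proof.
rewrite count_flatten sumnE !big_map (big_nth (0, [::])) size_zip size_ss minnn.
rewrite big_mkord; apply: eq_bigr => k _.
by rewrite nth_zip //= count_map.
Qed.

(** A pair occurs once exactly when its outer letter occurs once in [sg] and its inner letter once
    in the inserted word. *)
Lemma mus_inflate : mus inflate =
  \sum_(k < size sg) if count_mem (nth 0 sg k) sg == 1 then mus (nth [::] ss k) else 0.
Proof.
rewrite /inflate mus_std /mus count_pairs_word; apply: eq_bigr => k _.
have ks := ltn_ord k; case: ifPn => [uk|nk].
  apply: eq_count => b; rewrite count_pairs_word (bigD1 k) //= big1 ?addn0.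
    by congr (_ == 1); apply: eq_count => b' /=; rewrite xpair_eqE eqxx.
  move=> l lk; apply/eqP; rewrite -leqn0 leqNgt -has_count; apply/hasPn => b' _ /=.
  rewrite xpair_eqE negb_and; apply/orP; left; apply/eqP => e.
  have := count_mem1P ks uk l (ltn_ord l) e => /val_inj e'.
  by rewrite e' eqxx in lk.
rewrite ss_single //= addn0; apply/eqP; rewrite eqb0 count_pairs_word.
rewrite (eq_bigr (fun l : 'I_(size sg) => (nth 0 sg l == nth 0 sg k) : nat)).
  by move: nk; rewrite -sum1_count (big_nth 0) big_mkord big_mkcond.
move=> l _; case: eqP => [e|e]; last first.
  apply/eqP; rewrite -leqn0 leqNgt -has_count; apply/hasPn => b' _ /=.
  by rewrite xpair_eqE negb_and; apply/orP; left; apply/eqP.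
by rewrite ss_single ?e //= xpair_eqE !eqxx.
Qed.

End Inflation.

Lemma infl_unique w w' sg ss : inflates w sg ss -> inflates w' sg ss ->
  rgf w -> rgf w' -> w = w'.
Proof.
move=> iw iw' rw rw'; apply: rgf_inj; rewrite ?(infl_sum iw) ?(infl_sum iw') //.
move=> i j; rewrite -(infl_sum iw).
move=> /(infl_pos iw)[k [x [ks xc ->]]] /(infl_pos iw)[l [y [ls yc ->]]].
by rewrite (infl_kernel iw) // (infl_kernel iw').
Qed.

Lemma infl_inflate w sg ss : inflates w sg ss -> rgf w ->
  (forall k, k < size sg -> rgf (nth [::] ss k)) ->
  (forall k, k < size sg -> count_mem (nth 0 sg k) sg != 1 -> nth [::] ss k = [:: 0]) /\
  w = inflate sg ss.
Proof.
move=> iw rw rss.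
have ss1 k : k < size sg -> count_mem (nth 0 sg k) sg != 1 -> nth [::] ss k = [:: 0].
  (* A repeated letter has a segment of length 1, and [[:: 0]] is the only RGF of that length. *)
  move=> ks nk; have c1 : size (nth [::] ss k) = 1.
    apply/eqP; apply: contraNT nk => c1; apply/(count_mem1P ks) => l ls e.
    apply/eqP; rewrite eq_sym; apply: contraNT c1 => kl.
    by rewrite (infl_single iw ks ls kl (esym e)).
  have := rss _ ks; case: (nth [::] ss k) c1 => [|x [|y s]] // _.
  by rewrite /rgf /firsts /= => /eqP[->].
split=> //; apply: (infl_unique iw) => //; last exact: rgf_std.
by apply: inflates_inflate => //; [exact: infl_size iw | exact: infl_gt0 iw].
Qed.

(** * Cutting a word at its first closed prefix *)

Lemma closed01 : closed_itv 0 [:: 0; 1] 0 1.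
Proof. by split => // -[|[|i]] [|[|j]]. Qed.

Lemma inflates_cat (u v w : seq nat) : 0 < size u -> 0 < size v -> size w = size u + size v ->
  (forall i j, i < size u -> j < size u ->
     (nth 0 w i == nth 0 w j) = (nth 0 u i == nth 0 u j)) ->
  (forall i j, i < size v -> j < size v ->
     (nth 0 w (size u + i) == nth 0 w (size u + j)) = (nth 0 v i == nth 0 v j)) ->
  (forall i j, i < size u -> j < size v -> nth 0 w i != nth 0 w (size u + j)) ->
  inflates w [:: 0; 1] [:: u; v].
Proof.
move=> u0 v0 sw wu wv wuv; split => //; first by rewrite sw /= addn0.
- by move=> [|[|k]].
- by move=> [|[|k]] [|[|l]].
move=> [|[|k]] j [|[|l]] i //= _ _ jc ic; rewrite /starts /= ?addn0 ?add0n.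
- exact: wu.
- by apply/negbTE/wuv.
- by rewrite eq_sym; apply/negbTE/wuv.
- exact: wv.
Qed.

Lemma infl01_decomp w u v : inflates w [:: 0; 1] [:: u; v] -> decomp w.
Proof.
move=> iw; have := infl_closed_lift iw closed01.
rewrite /starts /= addn0 => cl; exists (size u) => //.
have u0 := infl_gt0 iw (isT : 0 < 2); have v0 := infl_gt0 iw (isT : 1 < 2).
by have := infl_sum iw; rewrite /= in u0 v0 * => ->; lia.
Qed.

Lemma decomp_inflates w : rgf w -> decomp w -> exists u v,
  [/\ inflates w [:: 0; 1] [:: u; v], rgf u, rgf v & ~ decomp u].
Proof.
move=> rw [k0 k0w cl0].
have ex : exists k, (0 < k < size w) && `[< closed_itv 0 w 0 k >].
  by exists k0; rewrite k0w; apply/asboolP.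
(* Minimality of [k] is what makes the first part indecomposable: a closed prefix of a closed prefix
   is closed in [w]. *)
case: (ex_minnP ex) => k /andP[/andP[k1 kw] /asboolP cl] kmin.
have su : size (take k w) = k by rewrite size_take kw.
exists (take k w), (std (drop k w)); split.
- apply: inflates_cat; rewrite ?su ?size_std ?size_drop ?subn_gt0 ?(subnKC (ltnW kw)) //.
  + by move=> i j ik jk; rewrite !nth_take.
  + by move=> i j ik jk; rewrite (std_kernel 0) ?size_drop // !nth_drop.
  + move=> i j ik jk; apply/eqP => e; have [_ _ cl'] := cl.
    have := cl' i (k + j); rewrite e ik /= => H.
    have : k + j < k by apply: H => //; rewrite ?(ltn_trans ik kw) -?ltn_subRL.
    by rewrite ltnNge leq_addr.
- exact: rgf_take.
- exact: rgf_std.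
move=> [j]; rewrite su => /andP[j0 jk] [_ _ clj].
have : (0 < j < size w) && `[< closed_itv 0 w 0 j >].
  rewrite j0 (ltn_trans jk kw); apply/asboolP; split => //.
    by rewrite (leq_trans (ltnW jk)) // ltnW.
  move=> x y xw yw e xj.
  have xk : x < k by lia.
  have yk : y < k.
    by have [_ _ cl'] := cl; have := cl' x y xw yw e; rewrite xk => /(_ isT).
  by apply: (clj x y); rewrite ?su ?nth_take.
by move=> /kmin; rewrite leqNgt jk.
Qed.

(** A shorter [u] would be a closed proper prefix of [u']. *)
Lemma infl01_size_le w u v u' v' : inflates w [:: 0; 1] [:: u; v] ->
  inflates w [:: 0; 1] [:: u'; v'] -> ~ decomp u' -> size u' <= size u.
Proof.
move=> iw iw' du; rewrite leqNgt; apply/negP => h; apply: du.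
have [] := infl_closed_lift iw closed01; rewrite /starts /= addn0 => u0 uw cl.
exists (size u); first by rewrite u0.
split => // [|i j iu ju e ci]; first exact: ltnW.
have lw := @infl_lt _ _ _ iw' 0; have /= li := lw i isT iu; have /= lj := lw j isT ju.
apply: (cl i j li lj) => //.
have := infl_kernel iw' (isT : 0 < 2) (isT : 0 < 2) iu ju.
by rewrite /= /starts /= e eqxx => /eqP.
Qed.

Lemma infl01_inj w u v u' v' : inflates w [:: 0; 1] [:: u; v] ->
  inflates w [:: 0; 1] [:: u'; v'] -> ~ decomp u -> ~ decomp u' ->
  rgf u -> rgf v -> rgf u' -> rgf v' -> u = u' /\ v = v'.
Proof.
move=> iw iw' du du' ru rv ru' rv'.
have su : size u = size u'.
  by apply/eqP; rewrite eqn_leq (infl01_size_le iw' iw) // (infl01_size_le iw iw').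
have sv : size v = size v'.
  by have := infl_sum iw; rewrite (infl_sum iw') /= su; lia.
split; apply: rgf_inj => // i j ic jc.
  have := infl_kernel iw (isT : 0 < 2) (isT : 0 < 2) ic jc.
  rewrite su in ic jc; have := infl_kernel iw' (isT : 0 < 2) (isT : 0 < 2) ic jc.
  by rewrite /= /starts /= => <- <-.
have := infl_kernel iw (isT : 1 < 2) (isT : 1 < 2) ic jc.
rewrite sv in ic jc; have := infl_kernel iw' (isT : 1 < 2) (isT : 1 < 2) ic jc.
by rewrite /= /starts /= su => <- <-.
Qed.

(** * Generating functions of inflations *)

Local Open Scope ring_scope.

Lemma flatten_map_uniq (T U : eqType) (f : T -> seq U) (s : seq T) :
  uniq s -> (forall x, x \in s -> uniq (f x)) ->
  (forall x y z, x \in s -> y \in s -> z \in f x -> z \in f y -> x = y) ->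
  uniq (flatten [seq f x | x <- s]).
Proof.
elim: s => //= x s IH /andP[xs us] uf inj; rewrite cat_uniq uf ?mem_head //=.
rewrite IH // ?andbT.
- apply/hasPn => z /flatten_mapP[y ys zy]; apply/negP => /= zx.
  move/negP: xs; apply.
  by rewrite (inj x y z) ?mem_head // inE ys orbT.
- by move=> y ys; apply: uf; rewrite inE ys orbT.
- by move=> y y' z ys ys'; apply: inj; rewrite inE (ys, ys') orbT.
Qed.

Section LabelledCompositions.
Variables (A S : eqType) (L : A -> nat -> seq S).

(* Sequences of words of total length n, the i-th word having a length k and   *)
(* lying in [L a k] where a is the i-th element of l.                          *)
Fixpoint comp (l : seq A) (n : nat) : seq (seq S) :=
  if l is a :: l' then
    flatten [seq flatten [seq [seq s :: ss | ss <- comp l' (n - i)%N] | s <- L a i]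
            | i <- iota 0 n.+1]
  else if n == 0%N then [:: [::]] else [::].

Lemma comp_cons a l n : comp (a :: l) n =
  flatten [seq flatten [seq [seq s :: ss | ss <- comp l (n - i)%N] | s <- L a i]
          | i <- iota 0 n.+1].
Proof. by []. Qed.

(** The product rule for generating functions. Weights depend on the label, so that the two factors
    of a cut and the letters of a simple word are treated alike. *)
Lemma sum_comp (R : comNzRingType) (v : A -> S -> R) (F : A -> fps R) l n :
  (forall a n, F a n = \sum_(s <- L a n) v a s) ->
  (\prod_(a <- l) F a) n = \sum_(ss <- comp l n) \prod_(p <- zip l ss) v p.1 p.2.
Proof.
move=> FE; elim: l n => [|a l IH] n.
  rewrite big_nil fcoef1 /=; case: (n == _); last by rewrite big_nil.
  by rewrite big_seq1 big_nil.
rewrite big_cons fcoefM comp_cons big_flatten big_map.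
rewrite -[iota 0 n.+1]/(index_iota 0 n.+1) big_mkord; apply: eq_bigr => i _.
rewrite big_flatten big_map FE mulr_suml; apply: eq_bigr => s _.
rewrite big_map IH mulr_sumr; apply: eq_bigr => ss _.
by rewrite big_cons.
Qed.

Variable sz : S -> nat.
Hypothesis L_size : forall a n s, s \in L a n -> sz s = n.

Lemma mem_comp l n ss : (ss \in comp l n) =
  [&& size ss == size l, sumn (map sz ss) == n &
      all (fun p => p.2 \in L p.1 (sz p.2)) (zip l ss)].
Proof.
elim: l n ss => [|a l IH] n ss.
  case: ss => [|s ss] /=; last by case: ifP.
  by rewrite eq_sym; case: ifP.
rewrite comp_cons; apply/flatten_mapP/and3P => [[i]|].
  rewrite mem_iota /= => hi /flatten_mapP[s sL /mapP[ss']].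
  rewrite IH => /and3P[/eqP s1 /eqP s2 s3] -> /=.
  by rewrite s1 s2 (L_size sL) sL s3 subnKC.
case: ss => [[]//|s ss /= [s1 /eqP s2 /andP[s3 s4]]].
exists (sz s); first by rewrite -[_ :: _]/(iota 0 n.+1) mem_iota /= add0n ltnS -s2 leq_addr.
apply/flatten_mapP; exists s => //; apply/mapP; exists ss => //.
rewrite IH; apply/and3P; split => //.
by rewrite -s2 addKn.
Qed.

Hypothesis L_uniq : forall a n, uniq (L a n).

Lemma comp_uniq l n : uniq (comp l n).
Proof.
elim: l n => [|a l IH] n; first by rewrite /=; case: ifP.
rewrite comp_cons; apply: (flatten_map_uniq (f := fun i => flatten [seq [seq s :: ss | ss <- comp l (n - i)%N] | s <- L a i]) (iota_uniq 0 n.+1)).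
  move=> i _; apply: flatten_map_uniq => // [s _|s s' ss _ _].
    by rewrite map_inj_uniq ?IH // => x y [].
  by move=> /mapP[t _ ->] /mapP[t' _ []].
move=> i j z _ _ /flatten_mapP[s si /mapP[t _ ->]] /flatten_mapP[s' sj /mapP[t' _ [e _]]].
by rewrite -(L_size si) e (L_size sj).
Qed.

End LabelledCompositions.

(** The empty word is an RGF but the series start at x, so length 0 is excluded; inserted words are
    thereby nonempty. *)
Definition rgfs n : seq (seq nat) :=
  if n == 0%N then [::] else [seq wseq w | w <- enum [pred w : word n | is_rgf w]].

Lemma mem_rgfs n s : (s \in rgfs n) = [&& (0 < n)%N, rgf s & size s == n].
Proof.
rewrite /rgfs; case: n => [|n] //=.
apply/mapP/andP => [[w]|[rs /eqP sn]].
  by rewrite mem_enum inE is_rgfP => rw ->; rewrite size_wseq.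
exists (word_of n.+1 s); last by rewrite wseq_word_of.
by rewrite mem_enum inE is_rgfP wseq_word_of.
Qed.

Lemma size_rgfs n s : s \in rgfs n -> size s = n.
Proof. by rewrite mem_rgfs => /and3P[_ _ /eqP]. Qed.

Lemma rgfs_uniq n : uniq (rgfs n).
Proof.
rewrite /rgfs; case: ifP => // _; rewrite map_inj_uniq ?enum_uniq //.
exact: wseq_inj.
Qed.

Lemma big_rgfs (R : nmodType) n (P : pred (seq nat)) (G : seq nat -> R) : (0 < n)%N ->
  \sum_(w : word n | is_rgf w && P (wseq w)) G (wseq w) = \sum_(s <- rgfs n | P s) G s.
Proof.
by case: n => // n _; rewrite /rgfs /= big_map big_enum_cond /= .
Qed.

Lemma Brgf_rgfs n : Brgf_fps n = \sum_(s <- rgfs n) 'X^(mus s).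
Proof.
rewrite /Brgf_fps /=; case: n => [|n]; first by rewrite /rgfs big_nil.
rewrite /Brgf -(big_rgfs xpredT (fun s => 'X^(mus s))) //.
by apply: eq_big => w; rewrite ?andbT // mu_wseq.
Qed.

Definition indecs n := [seq s <- rgfs n | ~~ `[< decomp s >]].
Definition decs n := [seq s <- rgfs n | `[< decomp s >]].
Definition simples n := [seq s <- rgfs n | `[< simple s >]].

Definition Ind_fps : fps {poly int} := Fps (fun n => \sum_(s <- indecs n) 'X^(mus s)).

(* Labels of the two parts of a word cut at its first closed prefix.           *)
Definition cut (first : bool) n := if first then indecs n else rgfs n.

Lemma size_cut b n s : s \in cut b n -> size s = n.
Proof. by case: b => /=; [rewrite mem_filter => /andP[_]|]; apply: size_rgfs. Qed.

Lemma cut_uniq b n : uniq (cut b n).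
Proof. by case: b; rewrite /cut ?filter_uniq ?rgfs_uniq. Qed.

Lemma mem_cuts n ss : ss \in comp cut [:: true; false] n ->
  exists u v, [/\ ss = [:: u; v], (0 < size u)%N /\ (0 < size v)%N, rgf u /\ rgf v,
                ~ decomp u & (size u + size v)%N = n].
Proof.
rewrite (mem_comp size_cut); case: ss => [|u [|v [|x ss]]] //= /and4P[/eqP sn hu hv _].
move: hu hv; rewrite /cut /indecs !mem_filter !mem_rgfs !eqxx.
move=> /andP[/asboolPn du /and3P[u0 ru _]] /and3P[v0 rv _].
exists u, v; split => //; last by rewrite addn0 in sn.
all: by split.
Qed.

Lemma inflates01 u v : (0 < size u)%N -> (0 < size v)%N ->
  inflates (inflate [:: 0%N; 1%N] [:: u; v]) [:: 0%N; 1%N] [:: u; v].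
Proof. by move=> u0 v0; apply: inflates_inflate => //= -[|[|k]]. Qed.

Lemma decs_perm n :
  perm_eq [seq inflate [:: 0%N; 1%N] ss | ss <- comp cut [:: true; false] n] (decs n).
Proof.
apply: uniq_perm.
- rewrite map_inj_in_uniq ?(comp_uniq size_cut cut_uniq) //.
  move=> ss ss' /mem_cuts[u [v [-> [u0 v0] [ru rv] du _]]].
  move=> /mem_cuts[u' [v' [-> [u0' v0'] [ru' rv'] du' _]]] e.
  have iw := inflates01 u0 v0; have iw' := inflates01 u0' v0'; rewrite -e in iw'.
  by have [-> ->] := infl01_inj iw iw' du du' ru rv ru' rv'.
- by rewrite filter_uniq ?rgfs_uniq.
move=> w; rewrite mem_filter mem_rgfs; apply/mapP/and4P.
  move=> [ss /mem_cuts[u [v [-> [u0 v0] [ru rv] du sn]]] ->].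
  have iw := inflates01 u0 v0; split; rewrite ?rgf_std //.
  - by apply/asboolP; apply: infl01_decomp iw.
  - by rewrite -sn addn_gt0 u0.
  - by rewrite (infl_sum iw) /= addn0 sn.
move=> [/asboolP dw n0 rw /eqP sn].
have [u [v [iw ru rv du]]] := decomp_inflates rw dw.
exists [:: u; v].
  rewrite (mem_comp size_cut) /= -sn (infl_sum iw) /= eqxx.
  rewrite /cut !mem_filter !mem_rgfs ru rv !eqxx !andbT.
  have /= -> := infl_gt0 iw (isT : (0 < 2)%N); have /= -> := infl_gt0 iw (isT : (1 < 2)%N).
  by rewrite !andbT; apply/asboolPn.
by have [] := infl_inflate iw rw _ => // -[|[|k]].
Qed.

Lemma mus_inflate01 u v : (0 < size u)%N -> (0 < size v)%N ->
  mus (inflate [:: 0%N; 1%N] [:: u; v]) = (mus u + mus v)%N.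
Proof.
move=> u0 v0; rewrite mus_inflate //=; first by rewrite big_ord_recl big_ord1.
by move=> [|[|k]].
Qed.

Lemma Ind_mul_Brgf n : (Ind_fps * Brgf_fps) n = \sum_(s <- decs n) 'X^(mus s).
Proof.
rewrite -(perm_big _ (decs_perm n)) big_map.
pose F b := if b then Ind_fps else Brgf_fps.
have -> : Ind_fps * Brgf_fps = \prod_(b <- [:: true; false]) F b.
  by rewrite !big_cons big_nil mulr1.
rewrite (@sum_comp _ _ cut {poly int} (fun _ s => 'X^(mus s))).
  rewrite big_seq [RHS]big_seq; apply: eq_bigr => ss /mem_cuts[u [v [-> [u0 v0] _ _ _]]].
  by rewrite [zip _ _]/= !big_cons big_nil mulr1 -exprD mus_inflate01.
by case=> // m; apply: Brgf_rgfs.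
Qed.

Lemma Brgf_Ind : Brgf_fps = Ind_fps + Ind_fps * Brgf_fps.
Proof.
apply: fpsP => n; rewrite fcoefD Ind_mul_Brgf Brgf_rgfs.
rewrite (bigID (fun s => `[< decomp s >])) [RHS]addrC.
by rewrite -big_filter; congr (_ + _); rewrite -big_filter.
Qed.

(** A repeated letter admits only the one-letter word and contributes x, a letter occurring once
    contributes B: this is the substitution of (x, B) in S. *)
Definition pieces (sg : seq nat) (a : nat) n : seq (seq nat) :=
  if count_mem a sg == 1%N then rgfs n else if n == 1%N then [:: [:: 0%N]] else [::].

Lemma size_pieces sg a n s : s \in pieces sg a n -> size s = n.
Proof.
rewrite /pieces; case: ifP => _; first exact: size_rgfs.
by case: eqP => // ->; rewrite inE => /eqP ->.
Qed.

Lemma pieces_uniq sg a n : uniq (pieces sg a n).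
Proof. by rewrite /pieces; case: ifP => _; rewrite ?rgfs_uniq //; case: ifP. Qed.

Lemma mem_pieces sg n ss : ss \in comp (pieces sg) sg n ->
  [/\ size ss = size sg, sumn (shape ss) = n,
      forall k, (k < size sg)%N -> rgf (nth [::] ss k) /\ (0 < size (nth [::] ss k))%N
    & forall k, (k < size sg)%N ->
        count_mem (nth 0%N sg k) sg != 1%N -> nth [::] ss k = [:: 0%N]].
Proof.
rewrite (mem_comp (@size_pieces sg)) => /and3P[/eqP s1 /eqP s2 /(all_nthP (0%N, [::]))].
rewrite size_zip s1 minnn => pP; split=> // k ks; have := pP k ks; rewrite nth_zip //= /pieces.
  case: ifP => _; first by rewrite mem_rgfs => /and3P[-> ->].
  by case: eqP => // _; rewrite inE => /eqP ->.
by move=> h /negPf h'; move: h; rewrite h'; case: eqP => // _; rewrite inE => /eqP.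
Qed.

Lemma inflates_pieces sg n ss : ss \in comp (pieces sg) sg n ->
  inflates (inflate sg ss) sg ss.
Proof.
by case/mem_pieces => s1 s2 s3 s4; apply: inflates_inflate => // k /s3[].
Qed.

(** Inserted words being nonempty, only simple words of length at most [n] inflate to length [n];
    this makes the sum over simple words finite. *)
Definition simple_upto n := flatten [seq simples m | m <- iota 3 (n - 2)].

Lemma mem_simple_upto n s : reflect
  [/\ (2 < size s)%N, (size s <= n)%N, rgf s & simple s] (s \in simple_upto n).
Proof.
apply: (iffP flatten_mapP) => [[m]|[s2 sn rs si]].
  rewrite mem_iota mem_filter mem_rgfs => hm /and4P[/asboolP si _ rs /eqP sm].
  have {}sm : size s = m := sm; split => //; rewrite sm; lia.
exists (size s); first by rewrite mem_iota; lia.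
by rewrite mem_filter mem_rgfs rs eqxx andbT; apply/andP; split; [apply/asboolP|lia].
Qed.

Lemma simple_upto_uniq n : uniq (simple_upto n).
Proof.
apply: flatten_map_uniq; first exact: iota_uniq.
  by move=> m _; rewrite filter_uniq ?rgfs_uniq.
move=> m m' s _ _; rewrite !mem_filter => /andP[_ /size_rgfs <-] /andP[_ /size_rgfs].
exact.
Qed.

Definition inflations n :=
  flatten [seq [seq (sg, ss) | ss <- comp (pieces sg) sg n] | sg <- simple_upto n].

Lemma indecs_perm n : (2 < n)%N ->
  perm_eq [seq inflate p.1 p.2 | p <- inflations n] (indecs n).
Proof.
move=> n2; apply: uniq_perm.
- rewrite map_inj_in_uniq; last first.
    move=> p p' /flatten_mapP[sg /mem_simple_upto[s2 _ rs si] /mapP[ss hss ->{p}]].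
    move=> /flatten_mapP[sg' /mem_simple_upto[s2' _ rs' si'] /mapP[ss' hss' ->{p'}]] /= e.
    have iw := inflates_pieces hss; have iw' := inflates_pieces hss'; rewrite -e in iw'.
    have [_ _ h _] := mem_pieces hss; have [_ _ h' _] := mem_pieces hss'.
    have [||-> -> //] := infl_inj iw iw' si si' s2 s2' rs rs'.
      by move=> k /h[].
    by move=> k /h'[].
  apply: flatten_map_uniq; first exact: simple_upto_uniq.
    move=> sg _; rewrite map_inj_uniq; last by move=> x y [].
    by apply: comp_uniq; [exact: size_pieces | exact: pieces_uniq].
  by move=> sg sg' _ _ _ /mapP[ss _ ->] /mapP[ss' _ []].
- by rewrite filter_uniq ?rgfs_uniq.
move=> w; rewrite mem_filter mem_rgfs; apply/mapP/and4P.
  move=> [p /flatten_mapP[sg /mem_simple_upto[s2 _ rs si] /mapP[ss hss ->{p}]] /= ->].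
  have iw := inflates_pieces hss; have [_ sn _ _] := mem_pieces hss.
  split; rewrite ?rgf_std //; last by rewrite (infl_sum iw) sn.
    by apply/asboolPn; apply: infl_indec iw si s2.
  by lia.
move=> [/asboolPn dw _ rw /eqP sn].
have w2 : (2 < size w)%N by rewrite sn.
have [sg [ss [iw rs si s2 rss]]] := indec_inflates dw w2.
have [ss1 ->] := infl_inflate iw rw rss.
exists (sg, ss) => //; apply/flatten_mapP; exists sg.
  by apply/mem_simple_upto; split => //; rewrite -sn (infl_size_le iw).
apply: map_f; rewrite (mem_comp (@size_pieces sg)) (infl_size iw) eqxx.
rewrite -/(shape ss) -(infl_sum iw) sn eqxx /=; apply/(all_nthP (0%N, [::])).
rewrite size_zip (infl_size iw) minnn => k ks; rewrite nth_zip ?(infl_size iw) //=.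
rewrite /pieces; case: ifP => uk; first by rewrite mem_rgfs rss // eqxx andbT (infl_gt0 iw).
by rewrite ss1 // uk.
Qed.

Definition piece_fps (R : comNzRingType) (b : fps R) (sg : seq nat) (a : nat) : fps R :=
  if count_mem a sg == 1%N then b else fpsX.

Lemma Ind_coef n : (2 < n)%N ->
  Ind_fps n = \sum_(sg <- simple_upto n) (\prod_(a <- sg) piece_fps Brgf_fps sg a) n.
Proof.
move=> n2; rewrite /Ind_fps /= -(perm_big _ (indecs_perm n2)) big_map big_flatten big_map.
apply: eq_bigr => sg _; rewrite big_map.
rewrite (@sum_comp _ _ (pieces sg) _ (fun a s =>
  if count_mem a sg == 1%N then 'X^(mus s) else 1)); last first.
  move=> a m; rewrite /piece_fps /pieces; case: ifP => _; first exact: Brgf_rgfs.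
  case: eqP => [->|]; first by rewrite big_seq1.
  by rewrite big_nil; case: m => [|[|m]].
rewrite big_seq [RHS]big_seq; apply: eq_bigr => ss hss.
have [s1 s2 s3 s4] := mem_pieces hss; rewrite [(_, _).1]/= [(_, _).2]/= (mus_inflate s1 s4).
rewrite (big_nth (0%N, [::])) size_zip s1 minnn big_mkord.
rewrite [LHS](big_morph (fun k => 'X^k) (exprD 'X) (expr0 _)) /=.
by apply: eq_bigr => k _; rewrite nth_zip //=; case: ifP.
Qed.

Lemma prod_piece_fps (R : comNzRingType) (b : fps R) sg :
  \prod_(a <- sg) piece_fps b sg a = fpsX ^+ (size sg - mus sg) * b ^+ mus sg.
Proof.
rewrite (bigID (fun a => count_mem a sg == 1%N)) /= mulrC; congr (_ * _).
  rewrite (eq_bigr (fun=> fpsX)); last by move=> a /negPf na; rewrite /piece_fps na.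
  rewrite big_const_seq iter_mulr_1 /mus; congr (_ ^+ _).
  by rewrite -(count_predC (fun a => count_mem a sg == 1%N) sg) addKn.
rewrite (eq_bigr (fun=> b)); last by move=> a na; rewrite /piece_fps na.
by rewrite big_const_seq iter_mulr_1.
Qed.

(** * The functional equation of simple words *)

Lemma rgfs1 : rgfs 1 =i [:: [:: 0%N]].
Proof.
move=> s; rewrite mem_rgfs !inE; case: s => [|x [|y s]]; rewrite ?andbF //=.
  by rewrite /rgf /firsts /= andbT.
by rewrite eqseq_cons andbF.
Qed.

Lemma rgfs2 : rgfs 2 =i [:: [:: 0%N; 0%N]; [:: 0%N; 1%N]].
Proof.
move=> s; rewrite mem_rgfs !inE; case: s => [|x [|y [|z s]]].
- by rewrite andbF.
- by rewrite andbF !eqseq_cons !andbF.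
- rewrite andbT -[[:: x; y]]/(rcons (rcons [::] x) y) !rgf_rcons /= leqn0 !eqseq_cons !andbT.
  by case: x => //=; case: y => [|[|y]].
by rewrite andbF !eqseq_cons !andbF.
Qed.

Lemma Brgf1 : Brgf_fps 1%N = 'X.
Proof.
rewrite Brgf_rgfs (perm_big [:: [:: 0%N]]) ?big_seq1 //.
by apply: uniq_perm; rewrite ?rgfs_uniq //; apply: rgfs1.
Qed.

Lemma indecs1 : perm_eq (indecs 1) [:: [:: 0%N]].
Proof.
apply: uniq_perm; rewrite ?filter_uniq ?rgfs_uniq // => s.
rewrite mem_filter rgfs1 !inE; case: eqP => [->|]; last by rewrite andbF.
by rewrite andbT; apply/asboolPn => -[[|[|k]]].
Qed.

(** The word 01 is cut after its first letter; 00 remains and is the source of the term x^2. *)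
Lemma indecs2 : perm_eq (indecs 2) [:: [:: 0%N; 0%N]].
Proof.
apply: uniq_perm; rewrite ?filter_uniq ?rgfs_uniq // => s.
rewrite mem_filter rgfs2 !inE andb_orr.
case: eqP => [->|_]; rewrite ?andbT ?andbF /=.
  rewrite (_ : ~~ _ = true) //; apply/asboolPn => -[[|[|k]] //= _ [_ _ cl]].
  by have := cl 0%N 1%N isT isT erefl isT.
case: eqP => [->|]; last by rewrite andbF.
rewrite andbT; apply/negbTE/negPn/asboolP; exists 1%N => //.
exact: closed01.
Qed.

Lemma simples1 : perm_eq (simples 1) [:: [:: 0%N]].
Proof.
apply: uniq_perm; rewrite ?filter_uniq ?rgfs_uniq // => s.
rewrite mem_filter rgfs1 !inE; case: eqP => [->|]; last by rewrite andbF.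
by rewrite andbT; apply/asboolP => a b [ab b1 _]; rewrite /= in b1 *; lia.
Qed.

Lemma simples2 : perm_eq (simples 2) [:: [:: 0%N; 0%N]; [:: 0%N; 1%N]].
Proof.
apply: uniq_perm; rewrite ?filter_uniq ?rgfs_uniq // => s.
rewrite mem_filter rgfs2; case s2 : (s \in _); last by rewrite andbF.
rewrite andbT; apply/asboolP => a b [ab b1 _].
have {}s2 : size s = 2%N by move: s2; rewrite !inE => /orP[] /eqP ->.
by rewrite s2 in b1 *; lia.
Qed.

Lemma Ind0 : Ind_fps 0%N = 0.
Proof. by rewrite /Ind_fps /= /indecs /rgfs /= big_nil. Qed.

Lemma Ind1 : Ind_fps 1%N = 'X.
Proof. by rewrite /Ind_fps [fcoef _ _]/= (perm_big _ indecs1) big_seq1. Qed.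

Lemma Ind2 : Ind_fps 2%N = 1.
Proof. by rewrite /Ind_fps [fcoef _ _]/= (perm_big _ indecs2) big_seq1. Qed.

Lemma card_words n (P : pred (word n)) (Q : pred (seq nat)) :
  (forall w, P w = rgf (wseq w) && Q (wseq w)) -> (0 < n)%N ->
  #|[set w | P w]| = count Q (rgfs n).
Proof.
move=> PQ n0; rewrite -!sum1_count -(big_rgfs Q (fun=> 1%N) n0) -sum1_card.
by apply: eq_bigl => w; rewrite inE PQ is_rgfP.
Qed.

Lemma srgfE n : (0 < n)%N -> srgf n = size (simples n).
Proof.
by move=> n0; rewrite size_filter; apply: card_words => // w; apply: is_simple_rgfP.
Qed.

Section TwoVariables.
Variable R : comNzRingType.
Implicit Types (a b : fps R) (f : fps (fps int)).

Lemma fps_eval2E f a b n : fps_eval2 f a b n =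
  \sum_(i < n.+1) \sum_(j < n.+1) (a ^+ i * b ^+ j) n *~ f i j.
Proof.
apply: eq_bigr => i _; apply: eq_bigr => j _.
by case: (f i j) => k; rewrite ?fcoefMn // !NegzE !mulrNz fcoefN -!pmulrn fcoefMn.
Qed.

Lemma fcoefXnM_small b i j n : b 0%N = 0 -> (n < i + j)%N -> (fpsX ^+ i * b ^+ j) n = 0.
Proof.
move=> b0 nij; rewrite fcoefXnM; case: ltnP => // ni.
by rewrite fcoefX_lt //; lia.
Qed.

Lemma mus_le_size (T : eqType) (s : seq T) : (mus s <= size s)%N.
Proof. exact: count_size. Qed.

Lemma Srgf_ge3E i j N : (i + j <= N)%N -> Srgf_ge3 i j =
  (count (fun s => (size s == i + j)%N && (mus s == j)) (simple_upto N))%:Z.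
Proof.
move=> ijN; rewrite /Srgf_ge3 /=; case: ltnP => ij.
  congr Posz.
  rewrite (@card_words _ _ (fun s => `[< simple s >] && (mus s == j))) => [|w|]; first last.
  - by apply: leq_trans ij.
  - by rewrite is_simple_rgfP mu_wseq andbA.
  rewrite -!size_filter; apply/perm_size/uniq_perm.
  - by rewrite filter_uniq ?rgfs_uniq.
  - by rewrite filter_uniq ?simple_upto_uniq.
  move=> s; rewrite !mem_filter mem_rgfs.
  apply/andP/andP => [[/andP[/asboolP si ->] /and3P[_ rs /eqP sn]]|].
    by rewrite sn eqxx; split=> //; apply/mem_simple_upto; rewrite sn.
  case=> /andP[/eqP sn ->] /mem_simple_upto[s2 _ rs si].
  rewrite sn in s2 *; rewrite rs eqxx !andbT; split; first exact/asboolP.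
  exact: leq_trans s2.
congr Posz; apply/esym/eqP; rewrite -leqn0 leqNgt -has_count; apply/hasPn => s.
case/mem_simple_upto => s2 _ _ _; apply/negP => /andP[/eqP sn _].
by rewrite sn in s2; rewrite ltnNge ij in s2.
Qed.

(** The double series becomes a finite sum over words. Leaving [N] free lets one list serve all
    coefficients up to [n], as the substitution of U requires. *)
Lemma eval2_Srgf b n N : b 0%N = 0 -> (n <= N)%N ->
  fps_eval2 Srgf_ge3 fpsX b n =
  (\sum_(s <- simple_upto N) fpsX ^+ (size s - mus s) * b ^+ mus s) n.
Proof.
move=> b0 nN; rewrite fps_eval2E fcoef_sum.
pose T i j := (fpsX ^+ i * b ^+ j) n.
transitivity (\sum_(i < n.+1) \sum_(j < n.+1) \sum_(s <- simple_upto N)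
    if (size s == i + j)%N && (mus s == j) then T i j else 0).
  apply: eq_bigr => i _; apply: eq_bigr => j _.
  rewrite -big_mkcond big_const_seq iter_addr_0.
  case: (leqP (i + j) n) => ij; first by rewrite (Srgf_ge3E (leq_trans ij nN)).
  by rewrite /T fcoefXnM_small // mul0rz mul0rn.
under eq_bigr do rewrite exchange_big.
rewrite exchange_big; apply: eq_bigr => s _.
have ms := mus_le_size s.
(* A word longer than [n] contributes a term of order above [n], hence nothing. *)
case: (leqP (size s) n) => sn; last first.
  rewrite fcoefXnM_small ?subnK //; apply: big1 => i _; apply: big1 => j _.
  by case: ifP => // /andP[/eqP sij _]; rewrite /T fcoefXnM_small // -sij.
have h1 : (size s - mus s < n.+1)%N by rewrite ltnS (leq_trans (leq_subr _ _)).
have h2 : (mus s < n.+1)%N by rewrite ltnS (leq_trans ms).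
rewrite (bigD1 (Ordinal h1)) //= [X in _ + X]big1 ?addr0 => [|i ni].
  rewrite (bigD1 (Ordinal h2)) //= [X in _ + X]big1 ?addr0 => [|j nj].
    by rewrite subnK // !eqxx.
  by case: ifP => // /andP[_ /eqP e]; case/eqP: nj; apply: val_inj.
apply: big1 => j _; case: ifP => // /andP[/eqP e1 /eqP e2]; case/eqP: ni.
by apply: val_inj; rewrite /= e1 e2 addnK.
Qed.

End TwoVariables.

Lemma eval2_Srgf_Brgf :
  fps_eval2 Srgf_ge3 fpsX Brgf_fps = Ind_fps - fpsC 'X * fpsX - fpsX ^+ 2.
Proof.
apply: fpsP => n; rewrite (@eval2_Srgf _ _ n n) //.
rewrite !fcoefB fcoefCM -[fpsX in RHS]expr1 !fcoefXn.
case: (ltnP 2 n) => n2.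
  rewrite Ind_coef // fcoef_sum (_ : (n == 1%N) = false) 1?(_ : (n == 2%N) = false); try lia.
  by rewrite mulr0 !subr0; apply: eq_bigr => s _; rewrite prod_piece_fps.
(* Lengths up to 2 are not reached by inflation; they account for the subtracted t x and x^2. *)
have -> : simple_upto n = [::] by rewrite /simple_upto (_ : (n - 2 = 0)%N) //; lia.
rewrite big_nil fcoef0; case: n n2 => [|[|[|n]]] // _.
- by rewrite Ind0 /= mulr0 !subr0.
- by rewrite Ind1 /= mulr1 subrr subr0.
- by rewrite Ind2 /= mulr0 subr0 subrr.
Qed.

Lemma Ind_mulD1 : Ind_fps * (1 + Brgf_fps) = Brgf_fps.
Proof. by rewrite mulrDr mulr1 -Brgf_Ind. Qed.

(** From Ind (1 + B) = B follows (B - Ind)(1 + B) = B^2. *)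
Lemma Ind_div : Brgf_fps ^+ 2 / (1 + Brgf_fps) = Brgf_fps - Ind_fps.
Proof.
have u : 1 + Brgf_fps \is a GRing.unit.
  by apply: fps_unit; rewrite fcoefD fcoef1 /= addr0.
apply: (mulIr u); rewrite divrK // mulrBl Ind_mulD1.
by ring.
Qed.

Lemma eval2_Srgf_eq :
  fps_eval2 Srgf_ge3 fpsX Brgf_fps = Brgf_fps - fpsC 'X * fpsX - fpsX ^+ 2
    - Brgf_fps ^+ 2 / (1 + Brgf_fps).
Proof. by rewrite eval2_Srgf_Brgf Ind_div; ring. Qed.

(** * Substitution for the parameter *)

Lemma sum_triangle (V : nmodType) N (c : nat -> nat -> V) :
  (forall i j, (N <= i + j)%N -> c i j = 0) ->
  \sum_(k < N) \sum_(i < k.+1) c i (k - i)%N = \sum_(i < N) \sum_(j < N) c i j.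
Proof.
move=> c0; transitivity (\sum_(k < N) \sum_(i < N | (i <= k)%N) c i (k - i)%N).
  by apply: eq_bigr => k _; rewrite (big_ord_widen_cond N xpredT (fun i => c i (k - i)%N)).
rewrite (exchange_big_dep xpredT) //=; apply: eq_bigr => i _.
have iN := ltnW (ltn_ord i).
transitivity (\sum_(0 + i <= k < N) c i (k - i)%N); first by rewrite big_geq_mkord.
rewrite big_addn big_mkord (big_ord_widen N (fun j => c i (j + i - i)%N)) ?leq_subr //.
rewrite big_mkcond; apply: eq_bigr => j _; rewrite addnK.
by case: ltnP => // h; rewrite c0 //; lia.
Qed.

Section Substitution.
Variable R : comNzRingType.
Implicit Types (f g : fps {poly R}) (u v : fps R) (p : {poly R}).

Lemma fpsC_is_zmod_morphism : zmod_morphism (@fpsC R).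
Proof. by move=> a b; apply: fpsP => -[|n] //=; rewrite subrr. Qed.

Lemma fpsC_is_monoid_morphism : monoid_morphism (@fpsC R).
Proof.
by split=> // a b; apply: fpsP => n; rewrite fcoefCM; case: n => [|n] //=; rewrite mulr0.
Qed.

HB.instance Definition _ :=
  GRing.isZmodMorphism.Build R (fps R) (@fpsC R) fpsC_is_zmod_morphism.
HB.instance Definition _ :=
  GRing.isMonoidMorphism.Build R (fps R) (@fpsC R) fpsC_is_monoid_morphism.

Definition eval_at u p : fps R := (map_poly (@fpsC R) p).[u].

Lemma eval_atD u : {morph eval_at u : p q / p + q}.
Proof. by move=> p q; rewrite /eval_at rmorphD hornerD. Qed.

Lemma eval_atB u : {morph eval_at u : p q / p - q}.
Proof. by move=> p q; rewrite /eval_at rmorphB hornerD hornerN. Qed.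

Lemma eval_atM u : {morph eval_at u : p q / p * q}.
Proof. by move=> p q; rewrite /eval_at rmorphM hornerM. Qed.

Lemma eval_atC u c : eval_at u c%:P = fpsC c.
Proof. by rewrite /eval_at map_polyC hornerC. Qed.

Lemma eval_atX u : eval_at u 'X = u.
Proof. by rewrite /eval_at map_polyX hornerX. Qed.

Lemma eval_at0 u : eval_at u 0 = 0.
Proof. by rewrite /eval_at rmorph0 horner0. Qed.

Lemma eval_at1 u : eval_at u 1 = 1.
Proof. by rewrite -polyC1 eval_atC. Qed.

Lemma eval_at_sum u I (r : seq I) (F : I -> {poly R}) :
  eval_at u (\sum_(i <- r) F i) = \sum_(i <- r) eval_at u (F i).
Proof. exact: (big_morph _ (eval_atD u) (eval_at0 u)). Qed.

(** The arguments are exchanged so that [subst u] can carry a ring morphism structure. *)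
Definition subst u f := fps_subst_param f u.

Lemma subst_coef u f n : subst u f n = \sum_(k < n.+1) eval_at u (f k) (n - k)%N.
Proof.
apply: eq_bigr => k _; rewrite mulrC fcoefXnM ltnNge -ltnS ltn_ord //=.
Qed.

Lemma subst_trunc N u f n : (n < N)%N ->
  subst u f n = (\sum_(k < N) eval_at u (f k) * fpsX ^+ k) n.
Proof.
move=> nN; rewrite subst_coef fcoef_sum.
rewrite (big_ord_widen N (fun k => eval_at u (f k) (n - k)%N)) // big_mkcond.
apply: eq_bigr => k _; rewrite mulrC fcoefXnM ltnS.
by case: leqP.
Qed.

Lemma subst_is_zmod_morphism u : zmod_morphism (subst u).
Proof.
move=> f g; apply: fpsP => n; rewrite fcoefB !subst_coef -sumrB.
by apply: eq_bigr => k _; rewrite fcoefB eval_atB.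
Qed.

Lemma subst_is_monoid_morphism u : monoid_morphism (subst u).
Proof.
split.
  apply: fpsP => n; rewrite subst_coef big_ord_recl big1 => [|i _].
    by rewrite !fcoef1 eqxx eval_at1 fcoef1 addr0 subn0.
  by rewrite fcoef1 eval_at0 fcoef0.
move=> f g; apply: fpsP => n; pose N := n.+1.
(* Both series are truncated to finite sums, which can be multiplied out; terms with [i + j] at
   least [N] do not reach coefficient [n]. *)
transitivity (((\sum_(i < N) eval_at u (f i) * fpsX ^+ i) *
               (\sum_(i < N) eval_at u (g i) * fpsX ^+ i)) n); last first.
  rewrite !fcoefM; apply: eq_bigr => i _.
  by rewrite !(@subst_trunc N) // /N ltnS ?leq_subr // -ltnS.
pose c i j := (eval_at u (f i) * eval_at u (g j) * fpsX ^+ (i + j)) n.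
transitivity (\sum_(i < N) \sum_(j < N) c i j).
  rewrite -sum_triangle => [|i j ij]; last first.
    by rewrite /c mulrC fcoefXnM ij.
  rewrite (@subst_trunc N) // fcoef_sum; apply: eq_bigr => k _.
  rewrite [(f * g) k]fcoefM eval_at_sum mulr_suml fcoef_sum; apply: eq_bigr => i _.
  by rewrite /c eval_atM subnKC // -ltnS.
rewrite mulr_suml fcoef_sum; apply: eq_bigr => i _.
rewrite mulr_sumr fcoef_sum; apply: eq_bigr => j _.
by rewrite /c exprD; congr fcoef; ring.
Qed.

HB.instance Definition _ u :=
  GRing.isZmodMorphism.Build (fps {poly R}) (fps R) (subst u) (subst_is_zmod_morphism u).
HB.instance Definition _ u :=
  GRing.isMonoidMorphism.Build (fps {poly R}) (fps R) (subst u) (subst_is_monoid_morphism u).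

Lemma substC u p : subst u (fpsC p) = eval_at u p.
Proof.
apply: fpsP => n; rewrite subst_coef big_ord_recl big1 ?addr0 ?subn0 // => i _.
by rewrite eval_at0 fcoef0.
Qed.

Lemma substX u : subst u fpsX = fpsX.
Proof.
apply: fpsP => -[|n]; rewrite subst_coef.
  by rewrite big_ord1 eval_at0.
rewrite big_ord_recl eval_at0 fcoef0 add0r big_ord_recl [fpsX _]/= eval_at1.
rewrite fcoef1 subn1 big1 ?addr0 => [|i _]; first by case: n.
by rewrite eval_at0 fcoef0.
Qed.

(** Congruence modulo x^n. *)
Definition eq_upto n u v := forall i, (i < n)%N -> u i = v i.

Lemma eq_upto_mul n u u' v v' : eq_upto n u u' -> eq_upto n v v' ->
  eq_upto n (u * v) (u' * v').
Proof.
move=> hu hv i ni; rewrite !fcoefM; apply: eq_bigr => j _.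
rewrite hu ?hv //; first exact: leq_ltn_trans (leq_subr _ _) ni.
by apply: leq_ltn_trans ni; rewrite -ltnS.
Qed.

Lemma eq_upto_eval_at n u v p : eq_upto n u v -> eq_upto n (eval_at u p) (eval_at v p).
Proof.
move=> uv; elim/poly_ind: p => [|p c IH]; first by rewrite !eval_at0.
rewrite !eval_atD !eval_atM !eval_atX !eval_atC => i ni.
by rewrite !fcoefD (eq_upto_mul IH uv).
Qed.

(** * Solving B(x, U) = x by x-adic iteration *)

Section InverseSeries.
Variable B : fps {poly R}.
Hypotheses (B0 : B 0%N = 0) (B1 : B 1%N = 'X).

(** The coefficient of x^(n+1) in B(x, u) = x, solved for the n-th coefficient of u, which the term
    t x of B isolates. *)
Let step u : fps R :=
  Fps (fun n => fpsX n.+1 - \sum_(k < n) eval_at u (B k.+2) (n - k.+1)%N).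

Let stepE u n :
  step u n = fpsX n.+1 - \sum_(k < n) eval_at u (B k.+2) (n - k.+1)%N.
Proof. by []. Qed.

Let subst_step u : subst u B = fpsX <-> u = step u.
Proof.
have BE n : subst u B n.+1 = u n + \sum_(k < n) eval_at u (B k.+2) (n - k.+1)%N.
  rewrite subst_coef big_ord_recl B0 eval_at0 fcoef0 add0r big_ord_recl B1 eval_atX.
  by rewrite subn1.
split=> [e|e]; apply: fpsP => n.
  by rewrite stepE -e BE addrK.
case: n => [|n]; first by rewrite subst_coef big_ord1 B0 eval_at0.
by rewrite BE {1}e stepE subrK.
Qed.

(** Coefficient [i] of [step u] involves evaluations at [u] only below index [i], so one order of
    precision is gained. *)
Let step_contract n u v : eq_upto n u v -> eq_upto n.+1 (step u) (step v).
Proof.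
move=> uv i ni; rewrite !stepE; congr (_ - _); apply: eq_bigr => k _.
by apply: (eq_upto_eval_at _ uv); have := ltn_ord k; lia.
Qed.

Lemma subst_inverse : exists U, unique (fun V => subst V B = fpsX) U.
Proof.
pose it n := iter n step 0.
have it_eq n m : (n <= m)%N -> eq_upto n (it n) (it m).
  elim: n m => [|n IH] [|m] // nm; apply: step_contract; exact: IH.
(* Coefficient [n] no longer changes from iterate [n.+1] on. *)
pose U : fps R := Fps (fun n => it n.+1 n).
have U_it n : eq_upto n U (it n) by move=> i ni; apply: it_eq.
have US : U = step U.
  by apply: fpsP => n; rewrite (step_contract (U_it n)).
exists U; split; first exact/subst_step.
move=> V /subst_step VS; apply: fpsP => n.
have : forall m, eq_upto m U V.
  by elim=> // m IH; rewrite US VS; apply: step_contract.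
by move=> /(_ n.+1); apply.
Qed.

End InverseSeries.

End Substitution.

(** * The series counting simple RGFs *)

Lemma srgf_eval2 : Srgf_fps = fpsX + fpsX ^+ 2 *+ 2 + fps_eval2 Srgf_ge3 fpsX fpsX.
Proof.
apply: fpsP => n; have X1 := fcoefXn int 1; rewrite expr1 in X1.
rewrite 2!fcoefD fcoefMn X1 fcoefXn.
rewrite (@eval2_Srgf _ _ n n) // fcoef_sum.
case: (ltnP 2 n) => n2; last first.
  have -> : simple_upto n = [::] by rewrite /simple_upto (_ : (n - 2 = 0)%N) //; lia.
  rewrite big_nil addr0 /Srgf_fps /=; case: n n2 => [|[|[|n]]] // _.
    by rewrite srgfE // (perm_size simples1).
  by rewrite srgfE // (perm_size simples2).
rewrite (_ : (n == 1%N) = false) 1?(_ : (n == 2%N) = false); try lia.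
rewrite mul0rn !add0r [LHS]/=.
have -> : (if n is 0%N then 0 else (srgf n)%:Z) = (srgf n)%:Z by case: n n2.
rewrite srgfE; last by lia.
rewrite (eq_bigr (fun s => ((size s == n) : nat)%:R)); last first.
  by move=> s _; rewrite -exprD subnK ?mus_le_size // fcoefXn eq_sym.
rewrite -natr_sum natz; congr Posz.
rewrite -big_mkcond /= sum1_count -size_filter; apply/perm_size/uniq_perm.
- by rewrite filter_uniq ?rgfs_uniq.
- by rewrite filter_uniq ?simple_upto_uniq.
move=> s; rewrite !mem_filter mem_rgfs.
apply/andP/andP => [[/asboolP si /and3P[_ rs /eqP sn]]|].
  by rewrite sn eqxx; split=> //; apply/mem_simple_upto; rewrite sn.
case=> /eqP sn /mem_simple_upto[s2 _ rs si].
by rewrite rs sn eqxx !andbT; split; [apply/asboolP | lia].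
Qed.

(** [subst U] is a ring morphism, hence commutes with finite sums and products; both evaluations are
    therefore first reduced to the list [simple_upto n]. *)
Lemma subst_eval2 U : subst U Brgf_fps = fpsX ->
  subst U (fps_eval2 Srgf_ge3 fpsX Brgf_fps) = fps_eval2 Srgf_ge3 fpsX fpsX.
Proof.
move=> UB; apply: fpsP => n; rewrite (@eval2_Srgf _ _ n n) //.
rewrite subst_coef (eq_bigr (fun k : 'I_n.+1 => eval_at U ((\sum_(s <- simple_upto n)
  fpsX ^+ (size s - mus s) * Brgf_fps ^+ mus s) k) (n - k)%N)); last first.
  by move=> k _; rewrite (@eval2_Srgf _ _ k n) // -ltnS.
rewrite -subst_coef rmorph_sum; congr fcoef; apply: eq_bigr => s _.
by rewrite rmorphM !rmorphXn /= substX UB.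
Qed.

(** At t = U the relation Ind (1 + B) = B gives Ind = x/(1 + x), and x + 2x^2 + x/(1 + x) - xU - x^2
    is the right-hand side. *)
Lemma Srgf_inverse U : subst U Brgf_fps = fpsX ->
  Srgf_fps = fpsX *+ 2 + fpsX ^+ 3 / (1 + fpsX) - fpsX * U.
Proof.
move=> UB; rewrite srgf_eval2 -(subst_eval2 UB) eval2_Srgf_Brgf.
rewrite !rmorphB rmorphM rmorphXn /= substX substC eval_atX.
have := congr1 (subst U) Ind_mulD1; rewrite rmorphM rmorphD rmorph1 /= UB => e.
have u : (1 + fpsX : fps int) \is a GRing.unit.
  by apply: fps_unit; rewrite fcoefD fcoef1 /= addr0.
apply: (mulIr u); rewrite [in RHS]mulrBl [in RHS]mulrDl divrK //.
rewrite mulrDl !mulrBl e; ring.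
Qed.

Theorem theorem6p3 :
  (let t : fps {poly rat} := fpsC 'X in
   let z : fps {poly rat} := fpsX in
   Brgf_egf = fps_exp (t * z + fps_exp z - 1 - z))
  /\ (forall n : nat, (1 <= n)%N ->
        Brgf n = \sum_(1 <= k < n.+1) \sum_(0 <= j < k.+1)
                   ('C(n, j) * stirling2 (n - j) (k - j))%:R * ('X - 1) ^+ j)
  /\ (forall n j : nat, (1 <= n)%N -> (j <= n)%N ->
        (Brgf n)`_j =
          ('C(n, j) * \sum_(0 <= i < (n - j).+1) stirling2_ge2 (n - j) i)%N%:Z)
  /\ (let t : fps {poly int} := fpsC 'X in
      let x : fps {poly int} := fpsX in
      fps_eval2 Srgf_ge3 x Brgf_fps =
        Brgf_fps - t * x - x ^+ 2 - Brgf_fps ^+ 2 / (1 + Brgf_fps))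
  /\ (let x : fps int := fpsX in
      exists U : fps int,
        unique (fun V : fps int => fps_subst_param Brgf_fps V = x) U
        /\ Srgf_fps = x *+ 2 + x ^+ 3 / (1 + x) - x * U).
Proof.
split; first exact: Brgf_egfE.
split; first exact: Brgf_stirling.
split; first exact: Brgf_coef.
split; first exact: eval2_Srgf_eq.
have [U UP] := @subst_inverse int Brgf_fps erefl Brgf1.
exists U; split=> //; apply: Srgf_inverse; exact: UP.1.
Qed.
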